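(* For any $p>1$ there exists a constant $C_p>0$ such that the following holds. Let $f\in C^1(\mathbb{R}^d)$ be a probability density function supported on $[0,1]^d$ with an absolutely continuous gradient, and let $$J(f)=\int_{\mathbb{R}^d}\frac{|\nabla f|^2}{f}$$ be its Fisher information. Then $$J(f)\le C_p\sum_{i=1}^d\|\partial_{ii}f\|_p .$$
   Context: $|\cdot|$ is the Euclidean norm and $\|\cdot\|_p$ is the $L_p$ norm on $\mathbb{R}^d$. $\partial_{ii}f=\partial^2f/\partial x_i^2$. The integrand of $J(f)$ is taken to be $0$ where $f=0$ (there $\nabla f=0$ since $f\ge0$ is $C^1$). Absolute continuity of the gradient is understood so that, for each $i$, $\partial_if$ is absolutely continuous along lines in direction $x_i$, so that $\partial_{ii}f$ exists almost everywhere and $\partial_i f$ is recovered by integrating it. *)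

(* Defs.v *)
From HB Require Import structures.
From mathcomp Require Import all_boot all_order all_algebra.
From mathcomp Require Import all_classical all_reals all_analysis.

Set Implicit Arguments.
Unset Strict Implicit.
Unset Printing Implicit Defensive.

Import Order.TTheory GRing.Theory Num.Theory.
Import numFieldNormedType.Exports.

Local Open Scope classical_set_scope.
Local Open Scope ring_scope.

(* The library has the product sigma-algebra on [n.-tuple T] but no Lebesgue
   measure on R^n; it is built here as the n-fold product of the Lebesgue
   measure on R. *)
Section LebesgueTuple.
Context {R : realType}.

Local Notation RT := (measurableTypeR R).

Definition cons_pair n (z : RT * n.-tuple RT) : n.+1.-tuple RT :=
  [tuple of z.1 :: z.2].

Lemma measurable_cons_pair n : measurable_fun setT (@cons_pair n).
Proof. exact: measurable_cons. Qed.

Section step.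
Variables (n : nat) (mu : {sigma_finite_measure set (n.-tuple RT) -> \bar R}).

Definition lebesgue_cons : set (n.+1.-tuple RT) -> \bar R :=
  pushforward (lebesgue_measure \x mu)%E (@cons_pair n).

Let lebesgue_cons0 : lebesgue_cons set0 = 0%E.
Proof. by rewrite /lebesgue_cons /pushforward preimage_set0 measure0. Qed.

Let lebesgue_cons_ge0 A : (0 <= lebesgue_cons A)%E.
Proof. exact: (measure_ge0 (lebesgue_measure \x mu)%E). Qed.

Let lebesgue_cons_sigma_additive : semi_sigma_additive lebesgue_cons.
Proof.
apply: measure_semi_sigma_additive; exact: measurable_cons_pair.
Qed.

HB.instance Definition _ := isMeasure.Build _ _ _ lebesgue_cons
  lebesgue_cons0 lebesgue_cons_ge0 lebesgue_cons_sigma_additive.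

Let lebesgue_cons_sigma_finite : sigma_finite setT lebesgue_cons.
Proof.
have /sigma_finiteP[F [FT ndF Foo]] := sigma_finiteT (@lebesgue_measure R).
have /sigma_finiteP[G [GT ndG Goo]] := sigma_finiteT mu.
pose g (t : n.+1.-tuple RT) : RT * n.-tuple RT := (thead t, [tuple of behead t]).
have gK : cancel (@cons_pair n) g.
  by move=> [x t]; rewrite /g theadE; congr pair; exact/val_inj.
have mg : measurable_fun setT g.
  by apply/measurable_fun_pair => /=; [exact: measurable_tnth|exact: measurable_behead].
exists (fun k => g @^-1` (F k `*` G k)).
  rewrite -preimage_bigcup [X in _ @^-1` X](_ : _ = setT)// -subTset => -[x t] _.
  have [i _ Fx] : (\bigcup_i F i) x by rewrite -FT.
  have [j _ Gt] : (\bigcup_i G i) t by rewrite -GT.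
  exists (maxn i j) => //; split.
  - by move: x Fx; exact/subsetPset/ndF/leq_maxl.
  - by move: t Gt; exact/subsetPset/ndG/leq_maxr.
move=> k; have [mF Fk] := Foo k; have [mG Gk] := Goo k; split.
  by rewrite -[X in measurable X]setTI; apply: mg => //; exact: measurableX.
rewrite /lebesgue_cons /pushforward -comp_preimage.
rewrite (_ : g \o _ = id); last by apply/funext => z; exact: gK.
by rewrite preimage_id product_measure1E// lte_mul_pinfty// ge0_fin_numE.
Qed.

HB.instance Definition _ := Measure_isSigmaFinite.Build _ _ _ lebesgue_cons
  lebesgue_cons_sigma_finite.
End step.

Fixpoint lebesgue_tuple n :
    {sigma_finite_measure set (n.-tuple RT) -> \bar R} :=
  if n is m.+1 then lebesgue_cons (lebesgue_tuple m)
  else dirac [tuple].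

(* This determines [lebesgue_tuple n] on the product sigma-algebra. *)
Lemma lebesgue_tuple_box n (A : 'I_n -> set RT) :
  (forall i, measurable (A i)) ->
  lebesgue_tuple n [set t | forall i, A i (tnth t i)] =
  (\prod_(i < n) lebesgue_measure (A i))%E.
Proof.
elim: n A => [|n ih] A mA.
  rewrite big_ord0 /= diracE mem_set//= => -[]//.
rewrite big_ord_recl /= /lebesgue_cons /pushforward.
set B := [set t : n.-tuple RT | forall i, A (lift ord0 i) (tnth t i)].
rewrite (_ : _ @^-1` _ = A ord0 `*` B); last first.
  apply/seteqP; split=> -[x t] /=.
    by move=> H; split=> [|i]; [have := H ord0|have := H (lift ord0 i)];
      rewrite /cons_pair ?tnthS.
  move=> [Ax Bt] i; case: (unliftP ord0 i) => [j|] ->; rewrite /cons_pair ?tnthS//.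
rewrite product_measure1E//; first by congr (_ * _)%E; exact: ih.
rewrite (_ : B = \bigcap_(i in [set: 'I_n]) ((@tnth n RT)^~ i @^-1` A (lift ord0 i))).
  apply: fin_bigcap_measurable => // i _.
  by rewrite -[X in measurable X]setTI; exact: measurable_tnth.
by apply/seteqP; split=> t /= H i; [move=> _|]; exact: H.
Qed.
End LebesgueTuple.

Section Calculus.
Context {R : realType} {d : nat}.
Implicit Types (f : 'rV[R]_d -> R) (x : 'rV[R]_d) (i : 'I_d).

(* Differential calculus takes place on ['rV[R]_d] and integration on
   [d.-tuple R]. *)
Definition row_of_tuple (t : d.-tuple (measurableTypeR R)) : 'rV[R]_d :=
  \row_i tnth t i.

Definition basis_vec i : 'rV[R]_d := delta_mx 0 i.

(* Total functions: where the derivative does not exist, ['D_v f x] is a fixed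
   default value of [R], independent of [x]. *)
Definition partial i f : 'rV[R]_d -> R := 'D_(basis_vec i) f.

Definition partial2 i f : 'rV[R]_d -> R := partial i (partial i f).

Definition grad f x : 'rV[R]_d := \row_i partial i f x.

(* The norm [`|v|] of ['rV[R]_d] is the sup norm. *)
Definition enorm (v : 'rV[R]_d) : R := Num.sqrt (\sum_i v 0 i ^+ 2).

Definition C1 f :=
  (forall x, differentiable f x) /\ (forall i, continuous (partial i f)).

Definition supported_on_unit_cube f :=
  forall x, f x != 0 -> forall i, 0 <= x 0 i <= 1.

Definition pdf f := (forall x, 0 <= f x) /\
  (\int[lebesgue_tuple d]_t (f (row_of_tuple t))%:E = 1)%E.

(* Since [y / 0 = 0], the integrand is 0 where [f] vanishes. *)
Definition fisher_information f : \bar R :=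
  (\int[lebesgue_tuple d]_t
    (enorm (grad f (row_of_tuple t)) ^+ 2 / f (row_of_tuple t))%:E)%E.

Definition Lp_norm (p : R) (g : 'rV[R]_d -> R) : \bar R :=
  Lnorm (lebesgue_tuple d) p%:E (fun t => (g (row_of_tuple t))%:E).

End Calculus.

Section AbsoluteContinuity.
Context {R : realType}.

Definition abs_continuous_on (a b : R) (g : R -> R) :=
  forall e : R, 0 < e -> exists2 delta : R, 0 < delta &
    forall (n : nat) (u v : 'I_n -> R),
      (forall k, [/\ a <= u k, u k <= v k & v k <= b]) ->
      trivIset setT (fun k => `]u k, v k[%classic) ->
      \sum_k (v k - u k) < delta -> \sum_k `|g (v k) - g (u k)| < e.

Definition abs_continuous (g : R -> R) :=
  forall a b, abs_continuous_on a b g.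

Definition abs_continuous_grad (d : nat) (f : 'rV[R]_d -> R) :=
  forall (i : 'I_d) (x : 'rV[R]_d),
    abs_continuous (fun s : R => partial i f (x + s *: basis_vec i)).

End AbsoluteContinuity.

(* Main.v *)
(** Write [C = (2p-1)/(p-1)].  On a line parallel to the [i]-th axis let [g] be
    the restriction of [f], [u = g'], [eps > 0] and [w = u^2/(g+eps)].  The
    function [phi = u w^(p-1)] is absolutely continuous with bounded support, so
    its derivative, which is [(2p-1) w^(p-1) u' - (p-1) w^p] almost everywhere,
    integrates to [0]; hence
      [(p-1) int w^p <= (2p-1) int w^(p-1) |u'|].
    By Tonelli this holds on [R^d] as well, and Hoelder's inequality yields
    [(int w^p)^(1/p) <= C ||d_ii f||_p], the left side being finite because
    [eps > 0] and [f] has compact support.  Since the unit unit_cube has measure 1,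
    [int w <= (int w^p)^(1/p)], and [eps] tends to [0] by monotone convergence.

    The almost everywhere differentiability of an absolutely continuous function
    and the fundamental theorem of calculus for it come from its total variation
    [V]: the Stieltjes measures of [V] and [V - u] are dominated by Lebesgue
    measure, so Radon-Nikodym and Lebesgue differentiation apply. *)
From HB Require Import structures.
Require Import Defs.
From mathcomp Require Import all_boot all_order all_algebra.
From mathcomp Require Import all_classical all_reals all_analysis.
From mathcomp Require Import measurable_realfun ring lra.

Set Implicit Arguments.
Unset Strict Implicit.
Unset Printing Implicit Defensive.

Import Order.TTheory GRing.Theory Num.Theory.
Import numFieldNormedType.Exports.

Local Open Scope classical_set_scope.
Local Open Scope ring_scope.

(** * Absolutely continuous functions of one variable *)

Section GlobalAC.
Context {R : realType}.
Implicit Types (F G : R -> R).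

(* Unlike [abs_continuous], [delta] does not depend on a bounded interval. *)
Definition global_ac F := forall e : R, 0 < e -> exists2 delta : R, 0 < delta &
  forall (n : nat) (u v : 'I_n -> R), (forall k, u k <= v k) ->
    trivIset setT (fun k => `]u k, v k[%classic) ->
    \sum_k (v k - u k) < delta -> \sum_k `|F (v k) - F (u k)| < e.

(** Enumerating [I] reduces this to ['I_n]. Families indexed by [unit] and by dependent pairs occur
    below. *)
Lemma global_ac_fin F (e : R) : global_ac F -> 0 < e -> exists2 delta : R, 0 < delta &
  forall (I : finType) (u v : I -> R), (forall k, u k <= v k) ->
    trivIset setT (fun k => `]u k, v k[%classic) ->
    \sum_k (v k - u k) < delta -> \sum_k `|F (v k) - F (u k)| < e.
Proof.
move=> Fac e0; have [delta d0 H] := Fac _ e0; exists delta => // I u v uv tuv.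
have bij : {on predT, bijective (@enum_val I I)} := onW_bij _ (@enum_val_bij I).
rewrite (reindex _ bij) [X in _ -> X < e](reindex _ bij) /=.
apply: (H _ (u \o @enum_val I I) (v \o @enum_val I I)) => [k|]; first exact: uv.
by move=> i j _ _ ij; apply/enum_val_inj; exact: (tuv _ _ Logic.I Logic.I ij).
Qed.

Lemma lebesgue_stieltjes_itvoc (F : cumulative R R) (a b : R) : a <= b ->
  lebesgue_stieltjes_measure F `]a, b]%classic = (F b - F a)%:E.
Proof.
move=> ab; rewrite /lebesgue_stieltjes_measure /= /measure_extension/=.
rewrite measurable_mu_extE/=; last exact: is_ocitv.
by rewrite wlength_itv_bnd.
Qed.


Lemma ocitv_ends (X : set R) : ocitv X ->
  exists p : R * R, p.1 <= p.2 /\ X = `]p.1, p.2]%classic.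
Proof.
case/ocitvP => [->|[x /ltW x12 ->]]; last by exists x.
by exists (0, 0); split => //=; rewrite set_itvoc0.
Qed.

Definition oc_ends (X : set R) : R * R :=
  if pselect (ocitv X) is left h then sval (cid (ocitv_ends h)) else (0, 0).

Lemma oc_endsP (X : set R) : ocitv X -> (oc_ends X).1 <= (oc_ends X).2 /\
  X = `](oc_ends X).1, (oc_ends X).2]%classic.
Proof. by rewrite /oc_ends; case: pselect => // h _; case: cid. Qed.

(** A member of the ring generated by the half-open intervals is a finite disjoint union of them, so
    both measures are finite sums over its pieces: one of lengths, the other of increments of
    [F]. *)
Lemma global_ac_ring (F : cumulative R R) (e : R) : global_ac F -> 0 < e ->
  exists2 delta : R, 0 < delta &
  forall X : set (SetRing.type (ocitv_type R)), measurable X ->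
    (lebesgue_measure X < delta%:E)%E ->
    (lebesgue_stieltjes_measure F X <= e%:E)%E.
Proof.
move=> Fac e0; have [delta d0 H] := global_ac_fin Fac e0; exists delta => // X.
move=> /SetRing.ring_finite_set[/= B [finB _ tB mB ->]].
have oB (Y : set R) : B Y -> ocitv Y by move=> BY; have := mB Y; rewrite inE; exact.
have moc (Y : set R) : B Y -> measurable (Y : set (measurableTypeR R)).
  by move=> /oB/oc_endsP[_ ->]; exact: measurable_itv.
rewrite !measure_fin_bigcup//.
rewrite 2!(fsbig_finite _ _ finB).
pose t := in_tuple (finmap.enum_fset (fset_set B)).
rewrite (big_tnth _ _ _ _ lebesgue_measure).
rewrite (big_tnth _ _ _ _ (lebesgue_stieltjes_measure F)) -/t.
pose u k := (oc_ends (tnth t k)).1; pose v k := (oc_ends (tnth t k)).2.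
have ti : injective (tnth t) by apply/tuple_uniqP; exact: finmap.fset_uniq.
have Bt k : B (tnth t k).
  by apply/set_mem; rewrite -(in_fset_set finB); exact: mem_tnth.
have uv k : u k <= v k by have [] := oc_endsP (oB _ (Bt k)).
have YE k : tnth t k = `]u k, v k]%classic by have [] := oc_endsP (oB _ (Bt k)).
rewrite (eq_bigr (fun Y => (v Y - u Y)%:E)) => [|Y _]; last first.
  by rewrite YE; exact: (lebesgue_stieltjes_itvoc idfun).
rewrite sumEFin lte_fin => dl.
rewrite (eq_bigr (fun Y => (F (v Y) - F (u Y))%:E)) => [|Y _]; last first.
  by rewrite YE; exact: lebesgue_stieltjes_itvoc.
rewrite sumEFin lee_fin.
(* Distinct pieces are disjoint as half-open intervals, hence also as open ones. *)
have tuv : trivIset setT (fun k => `]u k, v k[%classic).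
  move=> Y Z _ _ [x [Yx Zx]]; apply: ti; apply: (tB _ _ (Bt Y) (Bt Z)).
  by exists x; split; rewrite YE /=; [move: Yx|move: Zx];
    rewrite /= !in_itv/= => /andP[-> /ltW].
apply: le_trans (ltW (H _ u v uv tuv dl)).
by apply: ler_sum => Y _; exact: ler_norm.
Qed.

(** A null set is covered by countably many half-open intervals of total length below [delta]. Each
    finite union of them has Stieltjes measure at most [e], and continuity from below extends this
    bound to the whole cover. *)
Lemma global_ac_dominates (F : cumulative R R) : global_ac F ->
  lebesgue_stieltjes_measure F `<< (@lebesgue_measure R).
Proof.
move=> Fac N N0 A mA /N0 A0.
apply/eqP; rewrite eq_le measure_ge0 andbT.
apply/lee_addgt0Pr => e e0; rewrite add0e.
have [delta d0 H] := global_ac_ring Fac e0.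
(* As an outer measure this is an infimum over countable covers by half-open intervals, which a
   cover approaches within [delta]. *)
have {}A0 : mu_ext (wlength (@idfun R)) A = 0%E by exact: A0.
have : mu_ext (wlength (@idfun R)) A \is a fin_num by rewrite A0.
move=> /lb_ereal_inf_adherent-/(_ _ d0)[_/= [G [mG AG] <-]].
rewrite [X in (X + _)%E]A0 add0e => Gd.
have mG' i : measurable (G i : set (measurableTypeR R)).
  exact: sub_sigma_algebra.
(* The finite unions lie in the ring of intervals, so the preceding lemma applies to them. *)
pose U n := \bigcup_(i < n) G i.
have mU n : measurable (U n : set (measurableTypeR R)) by exact: bigcup_measurable.
have mUU : measurable (\bigcup_n U n : set (measurableTypeR R)).
  exact: bigcup_measurable.
have AU : A `<=` \bigcup_n U n.
  by move=> x /AG[i _ Gx]; exists i.+1 => //; exists i => /=.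
apply: (@le_trans _ _ (lebesgue_stieltjes_measure F (\bigcup_n U n))).
  by apply: le_measure; rewrite ?inE.
have ndU : nondecreasing_seq U.
  move=> m n mn; apply/subsetPset => x [i /= im Gx]; exists i => //=.
  exact: leq_trans im mn.
have cU := nondecreasing_cvg_mu (mu := lebesgue_stieltjes_measure F) mU mUU ndU.
rewrite -(cvg_lim _ cU)//; apply: lime_le; first by apply/cvg_ex; eexists; exact: cU.
near=> n; apply: H.
  apply: fin_bigcup_measurable => // i _; exact: SetRing.measurable_subring.
apply: le_lt_trans Gd.
apply: (@le_trans _ _ (\sum_(0 <= i < n) wlength idfun (G i))%E); last first.
  by apply: nneseries_lim_ge => i _ _; exact: (wlength_ge0 (@idfun R : cumulative R R)).
rewrite /U bigcup_mkord big_mkord.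
apply: (le_trans (@Boole_inequality _ _ _ lebesgue_measure G n (fun i _ => mG' i))).
apply: lee_sum => i _; have [ab ->] := oc_endsP (mG i).
rewrite wlength_itv_bnd//.
by rewrite -[leRHS](lebesgue_stieltjes_itvoc (@idfun R : cumulative R R) ab).
Unshelve. all: by end_near. Qed.

End GlobalAC.

(** * Total variation of an absolutely continuous function *)

Section GlobalAC2.
Context {R : realType}.
Implicit Types (F G : R -> R).
Local Notation TV := total_variation.

Lemma itv_partition_nth_le_nth (a b : R) (s : seq R) (i j : nat) :
  itv_partition a b s -> (i <= j)%N -> (j < (size s).+1)%N ->
  nth b (a :: s) i <= nth b (a :: s) j.
Proof.
move=> [ps _] ij js.
have := @sorted_leq_nth _ <=%R le_trans le_refl b (a :: s).
move=> /(_ _ i j _ _ ij); apply => //.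
  by apply: sub_path ps => x y /ltW.
by rewrite inE; exact: leq_ltn_trans ij js.
Qed.

(** Cutting each interval along its partition gives a new disjoint family with the same total
    length, so the [delta] of [F] still serves. The family is indexed by pairs of an interval and a
    position in its partition. *)
Lemma global_ac_variation F (e : R) : global_ac F -> 0 < e -> exists2 delta : R, 0 < delta &
  forall (I : finType) (u v : I -> R) (s : I -> seq R),
    (forall k, itv_partition (u k) (v k) (s k)) ->
    trivIset setT (fun k => `]u k, v k[%classic) ->
    \sum_k (v k - u k) < delta -> \sum_k variation (u k) (v k) F (s k) <= e.
Proof.
move=> Fac e0; have [delta d0 H] := global_ac_fin Fac e0; exists delta => // I u v s ps tuv.
pose N k i := nth (v k) (u k :: s k) i.
have Nle k (i j : nat) : (i <= j)%N -> (j < (size (s k)).+1)%N -> N k i <= N k j.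
  by move=> ij jk; exact: itv_partition_nth_le_nth.
have sumE (G : R -> R) k :
    \sum_(i < size (s k)) (G (N k i.+1) - G (N k i)) = G (v k) - G (u k).
  rewrite -(big_mkord predT (fun i => G (N k i.+1) - G (N k i))).
  rewrite telescope_sumr//.
  by rewrite /N (itv_partition_nth_size _ (ps k)).
pose J := {k : I & 'I_(size (s k))}.
pose U (j : J) := N (tag j) (tagged j); pose V (j : J) := N (tag j) (tagged j).+1.
have sumJ (G : forall k, 'I_(size (s k)) -> R) :
    \sum_k \sum_i G k i = \sum_(j : J) G (tag j) (tagged j).
  exact: (@sig_big_dep _ _ _ _ _ predT (fun=> predT) G).
move=> dl; have dlJ : \sum_j (V j - U j) < delta.
  by move: dl; rewrite -(eq_bigr _ (fun k _ => sumE id k)) sumJ.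
have -> : \sum_k variation (u k) (v k) F (s k) = \sum_j `|F (V j) - F (U j)|.
  rewrite -(sumJ (fun k i => `|F (N k i.+1) - F (N k i)|)).
  by apply: eq_bigr => k _; rewrite /variation big_mkord.
apply/ltW/H => //.
- by move=> [k i]; apply: Nle => //=; rewrite ltnS.
move=> [k i] [l j] _ _ /= [x []]; rewrite /U /V /= !in_itv/= => /andP[ix xi] /andP[jx xj].
(* Two pieces that meet lie in intervals that meet, hence in the same interval; within it the order
   of the partition points forces equal positions. *)
have kl : k = l.
  apply: tuv => //; exists x; rewrite /= !in_itv/=; split; apply/andP; split.
  - by apply: le_lt_trans ix; exact: (Nle k 0%N i isT (ltnW (ltn_ord i))).
  - apply: lt_le_trans xi _; apply: itv_partition_nth_le => //.
    by rewrite ltnS.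
  - by apply: le_lt_trans jx; exact: (Nle l 0%N j isT (ltnW (ltn_ord j))).
  - apply: lt_le_trans xj _; apply: itv_partition_nth_le => //.
    by rewrite ltnS.
subst l; congr existT; apply/val_inj/eqP; rewrite eqn_leq; apply/andP; split.
- rewrite leqNgt; apply/negP => ji.
  have := lt_trans ix xj; rewrite ltNge => /negP; apply; exact: (Nle _ _ _ ji (ltnW (ltn_ord _))).
- rewrite leqNgt; apply/negP => ji.
  have := lt_trans jx xi; rewrite ltNge => /negP; apply; exact: (Nle _ _ _ ji (ltnW (ltn_ord _))).
Qed.

(** The bound on variations along partitions does not depend on the partitions, so it passes to the
    supremum, taken in all intervals simultaneously. *)
Lemma global_ac_TV F (e : R) : global_ac F -> 0 < e -> exists2 delta : R, 0 < delta &
  forall (n : nat) (u v : 'I_n -> R), (forall k, u k <= v k) ->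
    trivIset setT (fun k => `]u k, v k[%classic) ->
    \sum_k (v k - u k) < delta -> (\sum_k TV (u k) (v k) F <= e%:E)%E.
Proof.
move=> Fac e0; have [delta d0 H] := global_ac_variation Fac e0; exists delta => //.
(* The case of one interval comes first: it makes every total variation finite, so that a partition
   can approach it. *)
have TVle a b : a <= b -> b - a < delta -> (TV a b F <= e%:E)%E.
  move=> ab bad; apply: ge_ereal_sup => _ [_ [s ps <-] <-]; rewrite lee_fin.
  have := @H unit (fun=> a) (fun=> b) (fun=> s); rewrite !big_const card_unit /= !addr0.
  by apply => //; move=> [] [].
move=> n u v uv tuv dl; apply/lee_addgt0Pr => r r0.
have TVfin k : TV (u k) (v k) F \is a fin_num.
  rewrite ge0_fin_numE ?total_variation_ge0//.
  apply: (@le_lt_trans _ _ e%:E); last exact: ltry.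
  apply: TVle => //; apply: le_lt_trans dl.
  by rewrite (bigD1 k)//= lerDl sumr_ge0// => i _; rewrite subr_ge0.
(* The error [r] is shared out in parts [r / n.+1], which makes sense for [n = 0] too. *)
have n0 : 0 < n.+1%:R :> R by [].
have ex k : exists s, itv_partition (u k) (v k) s /\
    (TV (u k) (v k) F <= (variation (u k) (v k) F s + r / n.+1%:R)%:E)%E.
  have rn0 : 0 < r / n.+1%:R by exact: divr_gt0.
  have [_ [_ [s ps <-] <-] sTV] := ub_ereal_sup_adherent rn0 (TVfin k).
  by exists s; split => //; rewrite EFinD -leeBlDr//; exact: ltW.
pose s k := sval (cid (ex k)).
have ps k : itv_partition (u k) (v k) (s k) by rewrite /s; case: cid => x [].
have sTV k : (TV (u k) (v k) F <= (variation (u k) (v k) F (s k) + r / n.+1%:R)%:E)%E.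
  by rewrite /s; case: cid => x [].
apply: (le_trans (lee_sum _ (fun k _ => sTV k))).
rewrite sumEFin -EFinD lee_fin big_split/= lerD//; first exact: H.
rewrite big_const_ord iter_addr_0 -[leLHS]mulr_natr mulrAC ler_pdivrMr//.
by rewrite ler_pM2l// ler_nat.
Qed.

Lemma global_ac_continuous F : global_ac F -> continuous F.
Proof.
move=> Fac x; apply/cvgrPdist_lt => e e0; have [delta d0 H] := global_ac_fin Fac e0.
near=> t.
have xt : `|x - t| < delta by near: t; exact: cvgr_dist_lt.
have := @H unit (fun=> Num.min x t) (fun=> Num.max x t).
rewrite !big_const card_unit /= !addr0.
have -> : `|F (Num.max x t) - F (Num.min x t)| = `|F x - F t|.
  by case: leP => _ //; rewrite distrC.
apply.
- by move=> _; rewrite ge_min !le_max lexx.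
- by move=> [] [].
- have := xt; rewrite ltr_norml => /andP[h1 h2].
  by rewrite maxEle minEle; case: ifP => _; lra.
Unshelve. all: by end_near. Qed.

(** The variation is at most [1] on intervals shorter than some [delta], and finitely many of these
    make up the interval from [x] to [y]. *)
Lemma global_ac_TV_fin F (x y : R) : global_ac F -> x <= y -> TV x y F \is a fin_num.
Proof.
move=> Fac xy; have [delta d0 H] := global_ac_TV Fac ltr01.
have small a b : a <= b -> b - a < delta -> (TV a b F < +oo)%E.
  move=> ab bad; apply: (@le_lt_trans _ _ 1%:E); last exact: ltry.
  have := @H 1%N (fun=> a) (fun=> b); rewrite !big_ord1; apply => //.
  by move=> i j; rewrite !ord1.
rewrite ge0_fin_numE ?total_variation_ge0//.
have d2 : 0 < delta / 2 by rewrite divr_gt0.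
(* This bounds the number of steps of length [delta / 2]; the induction on it moves [x] one step to
   the right. *)
have : y - x < (Num.bound ((y - x) / (delta / 2)))%:R * (delta / 2).
  rewrite -ltr_pdivrMr//; apply: le_lt_trans (archi_boundP _); first by [].
  by rewrite divr_ge0 ?subr_ge0// ltW.
move: (Num.bound _) => n; elim: n x xy => [|n ih] x xy.
  by rewrite mul0r ltNge subr_ge0 xy.
have [h _|h] := ltP (y - x) delta; first exact: small.
rewrite -natr1 mulrDl mul1r -ltrBlDr => hn.
have xxd : x <= x + delta / 2 by rewrite lerDl ltW.
have xdy : x + delta / 2 <= y by lra.
rewrite (total_variationD F xxd xdy); apply: lte_add_pinfty.
  by apply: small => //; lra.
by apply: ih => //; lra.
Qed.

(** The maximum makes the function constant to the left of [a], hence monotone on the whole line. *)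
Definition tv_fun (a : R) F (x : R) : R := fine (TV a (Num.max a x) F).

Lemma tv_funB (a : R) F x y : global_ac F -> x <= y ->
  (tv_fun a F y - tv_fun a F x)%:E = TV (Num.max a x) (Num.max a y) F.
Proof.
move=> Fac xy; rewrite /tv_fun.
have h1 : a <= Num.max a x by rewrite le_max lexx.
have h2 : Num.max a x <= Num.max a y by rewrite ge_max !le_max lexx xy orbT.
have h3 : a <= Num.max a y by exact: le_trans h1 h2.
rewrite (total_variationD F h1 h2) fineD ?global_ac_TV_fin// addrAC subrr add0r.
by rewrite fineK ?global_ac_TV_fin.
Qed.

(** Increments of [tv_fun] are variations over intervals clipped at [a]; clipping keeps them
    disjoint and does not lengthen them. Halving [e] turns the weak inequality of [global_ac_TV]
    into a strict one. *)
Lemma global_ac_tv_fun (a : R) F : global_ac F -> global_ac (tv_fun a F).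
Proof.
move=> Fac e e0; have e20 : 0 < e / 2 by rewrite divr_gt0.
have [delta d0 H] := global_ac_TV Fac e20; exists delta => // n u v uv tuv dl.
have muv k : Num.max a (u k) <= Num.max a (v k).
  by rewrite ge_max !le_max lexx uv orbT.
apply: (@le_lt_trans _ _ (e / 2)); last by rewrite ltr_pdivrMr// ltr_pMr// ltr1n.
rewrite -lee_fin -sumEFin.
rewrite (eq_bigr (fun k => TV (Num.max a (u k)) (Num.max a (v k)) F)); last first.
  move=> k _; rewrite -tv_funB// ger0_norm//.
  by rewrite -lee_fin tv_funB// total_variation_ge0.
apply: H => //.
- move=> i j _ _ [x /= []]; rewrite !in_itv/= !gt_max !lt_max.
  move=> /andP[/andP[ax ux] /orP[xa|xv]]; first by rewrite ltNge (ltW ax) in xa.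
  move=> /andP[/andP[_ ux'] /orP[xa|xv']]; first by rewrite ltNge (ltW ax) in xa.
  by apply: tuv => //; exists x; rewrite /= !in_itv/= ux xv ux' xv'.
- apply: le_lt_trans dl; apply: ler_sum => k _.
  by have := uv k; case: (leP a (u k)); case: (leP a (v k)) => h1 h2 h3; lra.
Qed.

Lemma tv_fun_nd (a : R) F : global_ac F -> {homo tv_fun a F : x y / x <= y}.
Proof.
move=> Fac x y xy; rewrite -subr_ge0 -lee_fin tv_funB// total_variation_ge0//.
by rewrite ge_max !le_max lexx xy orbT.
Qed.

Lemma tv_funB_ge (a : R) F x y : global_ac F -> (forall z, z <= a -> F z = F a) ->
  x <= y -> `|F y - F x| <= tv_fun a F y - tv_fun a F x.
Proof.
move=> Fac Fa xy; rewrite -lee_fin tv_funB//.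
have Fm z : F z = F (Num.max a z) by case: leP => // /ltW /Fa.
rewrite (Fm x) (Fm y); apply: total_variation_ge.
by rewrite ge_max !le_max lexx xy orbT.
Qed.

Lemma tv_fun_cst (a b : R) F x : global_ac F -> a <= b ->
  (forall z, b <= z -> F z = F b) -> b <= x -> tv_fun a F x = tv_fun a F b.
Proof.
move=> Fac ab Fb bx; apply/eqP; rewrite -subr_eq0 -eqe tv_funB//.
rewrite !max_r//; last exact: le_trans bx.
(* Beyond [b] the function [F] is constant, hence nondecreasing, and its variation there is the
   difference of two equal values. *)
rewrite nondecreasing_total_variation// ?(Fb x) ?subrr//.
move=> y z; rewrite !in_itv/= => /andP[yb _] /andP[zb _] _.
by rewrite (Fb y)// (Fb z).
Qed.

End GlobalAC2.

(** * Densities and almost everywhere differentiability *)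

Section GlobalAC3.
Context {R : realType}.
Implicit Types (F G : R -> R).
Local Notation mu := (@lebesgue_measure R).

(** The Stieltjes measure of [F] is finite because [F] is bounded, and dominated by Lebesgue
    measure; [h] is its Radon-Nikodym density. *)
Lemma global_ac_nd_density F (M : R) : global_ac F -> {homo F : x y / x <= y} ->
  (forall x, `|F x| <= M) ->
  exists h : R -> R, mu.-integrable setT (EFin \o h) /\
    forall x y, x <= y -> (F y - F x)%:E = (\int[mu]_(t in `]x, y]) (h t)%:E)%E.
Proof.
move=> Fac Fnd FM.
have Frc : right_continuous F by apply: right_continuousW; exact: global_ac_continuous.
pose F' : cumulative R R := HB.pack F (isCumulative.Build R _ R F Fnd Frc).
pose nu : {measure set (measurableTypeR R) -> \bar R} := lebesgue_stieltjes_measure F'.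
have nuT : (nu setT <= (2 * M)%:E)%E.
  have ndU : nondecreasing_seq (fun n => `](- n%:R), n%:R] : set R)%classic.
    move=> m n mn; apply/subsetPset => x /=; rewrite !in_itv/= => /andP[h1 h2].
    have mnR : m%:R <= n%:R :> R by rewrite ler_nat.
    by apply/andP; split; lra.
  rewrite -(bigcup_itvT false false).
  have cU := @nondecreasing_cvg_mu _ _ _ nu _
    (fun n => measurable_itv _) (bigcup_measurable (fun n _ => measurable_itv _)) ndU.
  rewrite -(cvg_lim _ cU)//; apply: lime_le.
    by apply/cvg_ex; eexists; exact: cU.
  apply: nearW => n; rewrite /nu /=.
  rewrite lebesgue_stieltjes_itvoc; last by have := ler0n R n; lra.
  rewrite lee_fin; have := FM n%:R; have := FM (- n%:R).
  rewrite !ler_norml => /andP[? ?] /andP[? ?] /=; lra.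
have finnu : fin_num_fun nu.
  move=> A mA; rewrite ge0_fin_numE//; apply: (@le_lt_trans _ _ (nu setT)).
    by apply: le_measure; rewrite ?inE.
  by apply: le_lt_trans nuT _; exact: ltry.
pose nu' : {finite_measure set (measurableTypeR R) -> \bar R} :=
  HB.pack (nu : set (measurableTypeR R) -> \bar R) nu (Measure_isFinite.Build _ _ _ nu finnu).
have nudom : nu' `<< mu by exact: global_ac_dominates.
have [f [f0 ffin fint fE]] := radon_nikodym_sigma_finite nudom.
exists (fine \o f); have ff : EFin \o (fine \o f) = f.
  by apply/funext => x /=; rewrite fineK.
split; first by rewrite ff.
move=> x y xy; rewrite -(lebesgue_stieltjes_itvoc F' xy).
rewrite -[LHS]/(nu' _) fE; last exact: measurable_itv.
by apply: eq_integral => z _; rewrite /= fineK.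
Qed.

(** Jordan decomposition: [F] is the difference of [V] and [V - F], both nondecreasing, and bounded
    because they are constant on either side of the interval from [a] to [b]. *)
Lemma global_ac_density F (a b : R) : global_ac F -> a <= b ->
  (forall x, x <= a -> F x = F a) -> (forall x, b <= x -> F x = F b) ->
  exists h : R -> R, mu.-integrable setT (EFin \o h) /\
    forall x y, x <= y -> (F y - F x)%:E = (\int[mu]_(t in `]x, y]) (h t)%:E)%E.
Proof.
move=> Fac ab Fa Fb.
set V := tv_fun a F.
have Vac : global_ac V by exact: global_ac_tv_fun.
have Va x : x <= a -> V x = V a.
  by move=> xa; rewrite /V /tv_fun maxxx max_l.
have Vb x : b <= x -> V x = V b by exact: tv_fun_cst.
have Wac : global_ac (V \- F).
  move=> e e0; have e2 : 0 < e / 2 by rewrite divr_gt0.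
  have [d1 d10 H1] := Vac _ e2; have [d2 d20 H2] := Fac _ e2.
  exists (Num.min d1 d2); first by rewrite lt_min d10.
  move=> n u v uv tuv; rewrite lt_min => /andP[l1 l2].
  rewrite (splitr e); apply: le_lt_trans (ltrD (H1 _ _ _ uv tuv l1) (H2 _ _ _ uv tuv l2)).
  rewrite -big_split/=; apply: ler_sum => k _; apply: le_trans (ler_normB _ _).
  by rewrite le_eqVlt; apply/orP; left; apply/eqP; congr `|_|; ring.
have bnd G : {homo G : x y / x <= y} -> (forall x, x <= a -> G x = G a) ->
    (forall x, b <= x -> G x = G b) -> forall x, `|G x| <= `|G a| + `|G b|.
  move=> Gnd Ga Gb x.
  have h1 : G a <= G x by case: (leP a x) => [/Gnd//|/ltW/Ga ->].
  have h2 : G x <= G b by case: (leP x b) => [/Gnd//|/ltW/Gb ->].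
  have := ler_norm (G b); have := ler_norm (- G a); rewrite normrN.
  have := normr_ge0 (G a); have := normr_ge0 (G b).
  by move=> ? ? ? ?; rewrite ler_norml; apply/andP; split; lra.
have Vnd : {homo V : x y / x <= y} by exact: tv_fun_nd.
have Wnd : {homo V \- F : x y / x <= y}.
  move=> x y xy /=; have := le_trans (ler_norm _) (tv_funB_ge Fac Fa xy).
  by rewrite -/V; lra.
have [h1 [ih1 h1E]] := global_ac_nd_density Vac Vnd (bnd _ Vnd Va Vb).
have Wa x : x <= a -> (V \- F) x = (V \- F) a by move=> xa /=; rewrite Va// Fa.
have Wb x : b <= x -> (V \- F) x = (V \- F) b by move=> xa /=; rewrite Vb// Fb.
have [h2 [ih2 h2E]] := global_ac_nd_density Wac Wnd (bnd _ Wnd Wa Wb).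
exists (h1 \- h2); split.
  rewrite (_ : EFin \o _ = (EFin \o h1) \- (EFin \o h2))%E; last exact/funext.
  exact: integrableB.
move=> x y xy.
have -> : (F y - F x)%:E = ((V y - V x)%:E - ((V \- F) y - (V \- F) x)%:E)%E.
  by rewrite -EFinB /=; congr EFin; ring.
rewrite h1E// h2E// -integralB//=.
  exact: integrableS ih1.
exact: integrableS ih2.
Qed.

(** To the right of [c], [F] is [F c] plus the integral of [h] from [c], and Lebesgue
    differentiation applies to that integral. *)
Lemma global_ac_ae_derivable F (a b c : R) : global_ac F -> a <= b ->
  (forall x, x <= a -> F x = F a) -> (forall x, b <= x -> F x = F b) ->
  exists h : R -> R, [/\ mu.-integrable setT (EFin \o h),
    forall x y, x <= y -> (F y - F x)%:E = (\int[mu]_(t in `]x, y]) (h t)%:E)%E &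
    {ae mu, forall x, c < x -> derivable F x 1 /\ 'D_1 F x = h x}].
Proof.
move=> Fac ab Fa Fb; have [h [ih hE]] := global_ac_density Fac ab Fa Fb.
exists h; split => //.
have ihy y : mu.-integrable [set` Interval (BRight c) (BRight y)] (EFin \o h).
  exact: integrableS ih.
have lh : locally_integrable [set: R] h by apply: open_integrable_locally => //; exact: openT.
have := FTC1 ihy lh; apply: filterS; first exact: (ae_filter_ringOfSetsType mu).
move=> x /= H cx; have [dx Dx] := H cx.
set G := fun y => (\int[mu]_(t in [set` Interval (BRight c) (BRight y)]) h t)%R in dx Dx.
(* The identity holds for [y >= c], hence on a neighbourhood of any [x > c]. *)
have GF : {near x, (fun y => F c + G y) =1 F}.
  near=> y; have cy : c <= y by near: y; exact: (cvgr_ge x).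
  by rewrite /G /Rintegral -hE// addrC subrK.
have dG : is_derive x 1 (fun y => F c + G y) (h x).
  rewrite -[h x]add0r; apply: is_deriveD.
  by rewrite -Dx derive1E; apply: DeriveDef.
by have [dF DF] := near_eq_is_derive GF dG; split.
Unshelve. all: by end_near. Qed.

End GlobalAC3.

(** * The one-dimensional inequality *)

Section OneDim.
Context {R : realType}.
Local Notation mu := (@lebesgue_measure R).

Lemma global_ac_of_bound (F G : R -> R) (K L : R) : global_ac F -> 0 <= K -> 0 <= L ->
  (forall x y, `|G x - G y| <= K * `|F x - F y| + L * `|x - y|) -> global_ac G.
Proof.
move=> Fac K0 L0 GF e e0.
(* Adding [1] allows division even when [K] or [L] is [0]. *)
have K1 : 0 < K + 1 by lra. have L1 : 0 < L + 1 by lra.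
have eK : 0 < e / 2 / (K + 1) by rewrite !divr_gt0.
have eL : 0 < e / 2 / (L + 1) by rewrite !divr_gt0.
have [d d0 H] := Fac _ eK.
exists (Num.min d (e / 2 / (L + 1))); first by rewrite lt_min d0.
move=> n u v uv tuv; rewrite lt_min => /andP[l1 l2].
apply: (@le_lt_trans _ _ (K * \sum_k `|F (v k) - F (u k)| + L * \sum_k (v k - u k))).
  rewrite !mulr_sumr -big_split/=; apply: ler_sum => k _.
  by rewrite (le_trans (GF _ _))// (ger0_norm (_ : 0 <= v k - u k)) ?subr_ge0.
have := H _ _ _ uv tuv l1; rewrite ltr_pdivlMr// => h1.
move: l2; rewrite ltr_pdivlMr// => h2.
have s1 : 0 <= \sum_k `|F (v k) - F (u k)| by exact: sumr_ge0.
have s2 : 0 <= \sum_k (v k - u k) by apply: sumr_ge0 => k _; rewrite subr_ge0.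
by nra.
Qed.

Lemma lip_of_derive (f df : R -> R) (K a b : R) :
  (forall x, x \in `[a, b] -> is_derive x 1 f (df x)) ->
  (forall x, x \in `[a, b] -> `|df x| <= K) ->
  {in `[a, b] &, forall x y, `|f x - f y| <= K * `|x - y|}.
Proof.
move=> fdf dfK.
suff H x y : x \in `[a, b] -> y \in `[a, b] -> x <= y -> `|f x - f y| <= K * `|x - y|.
  move=> x y xab yab; case: (leP x y) => [xy|/ltW yx]; first exact: H.
  by rewrite distrC (distrC x); exact: H.
rewrite !in_itv/= => /andP[ax xb] /andP[ay yb] xy.
have sub z : z \in `[x, y] -> z \in `[a, b].
  rewrite !in_itv/= => /andP[xz zy].
  by rewrite (le_trans ax xz) (le_trans zy yb).
have dxy z : z \in `]x, y[ -> is_derive z 1 f (df z).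
  move=> zxy; apply: fdf; apply: sub.
  by move: zxy; rewrite !in_itv/= => /andP[/ltW -> /ltW ->].
have cxy : {within `[x, y], continuous f}.
  apply: continuous_in_subspaceT => z; rewrite inE => zxy.
  apply: differentiable_continuous; apply/derivable1_diffP.
  by have [] := fdf z (sub _ zxy).
have [c cxy' E] := MVT_segment xy dxy cxy.
by rewrite distrC E normrM (distrC x) ler_wpM2r// dfK// sub.
Qed.

(* This is [sgn s * |s|^(2q+1)]. *)
Definition odd_powR (q s : R) : R := s * (s ^+ 2) `^ q.

(** Away from [0] this is the product and chain rules. At [0] the difference quotient with step [h]
    is [(h^2)^q], which tends to [0] since [q > 0]. *)
Lemma is_derive_odd_powR (q s : R) : 0 < q ->
  is_derive s 1 (odd_powR q) ((2 * q + 1) * (s ^+ 2) `^ q).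
Proof.
move=> q0; have [->|s0] := eqVneq s 0.
  rewrite expr0n/= powR0 ?gt_eqF// mulr0.
  have cv : h^-1 *: (odd_powR q (h *: 1 + 0) - odd_powR q 0) @[h --> 0^'] --> (0 : R).
    apply/cvgrPdist_lt => e e0.
    (* If [|h| < 1] and [|h| < e^(1/q)], then [h^2 <= |h| < e^(1/q)], so [(h^2)^q < e]. *)
    have e1 : 0 < e `^ q^-1 by exact: powR_gt0.
    near=> h.
    have h0 : h != 0 by near: h; exact: nbhs_dnbhs_neq.
    rewrite /odd_powR mul0r subr0 addr0 /GRing.scale/= mulr1 mulrA mulVf// mul1r.
    rewrite sub0r normrN ger0_norm ?powR_ge0//.
    rewrite -[ltRHS]powRr1 ?(ltW e0)// -(mulVf (lt0r_neq0 q0)) powRrM.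
    apply: gt0_ltr_powR => //; rewrite ?nnegrE ?sqr_ge0 ?(ltW e1)//.
    have h1 : `|h| < 1 by near: h; exact: dnbhs0_lt.
    have h2 : `|h| < e `^ q^-1 by near: h; exact: dnbhs0_lt.
    rewrite -real_normK ?num_real// expr2; apply: le_lt_trans h2.
    by rewrite ler_piMl// ltW.
  by apply: DeriveDef; [apply/cvg_ex; exists 0|apply: cvg_lim].
have s2 : 0 < s ^+ 2 by rewrite exprn_even_gt0.
have d1 : is_derive s 1 (fun s : R => s ^+ 2) (2 * s).
  by apply: is_derive_eq; rewrite /GRing.scale/=; ring.
have d2 : is_derive s 1 ((fun t => t `^ q) \o (fun s : R => s ^+ 2))
    ((q * (s ^+ 2) `^ (q - 1)) * (2 * s)).
  by apply: is_derive1_comp; exact: is_derive1_powR.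
have d3 : is_derive s 1 (odd_powR q)
    (s *: ((q * (s ^+ 2) `^ (q - 1)) * (2 * s)) + (s ^+ 2) `^ q *: (1 : R)).
  exact: (is_deriveM (f := id)).
apply: is_derive_eq d3 _; rewrite /GRing.scale/=.
have := mulr_powRB1 (ltW s2) q0 => <-.
ring.
Unshelve. all: by end_near. Qed.

(** Clipping all endpoints to the interval from [a] to [b] leaves the values of [u] unchanged, keeps
    the intervals disjoint and does not lengthen them. *)
Lemma global_ac_of_abs_continuous_on (a b : R) (u : R -> R) : a <= b ->
  abs_continuous_on a b u ->
  (forall x, x <= a -> u x = u a) -> (forall x, b <= x -> u x = u b) -> global_ac u.
Proof.
move=> ab uac ua ub e e0; have [d d0 H] := uac _ e0; exists d => // n x y xy txy dl.
pose c z := Num.max a (Num.min z b).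
have uc z : u z = u (c z).
  rewrite /c; case: (leP z b) => [zb|/ltW bz]; last by rewrite max_r// ub.
  by case: (leP a z) => // /ltW/ua.
have nd z t : z <= t -> c z <= c t.
  by move=> zt; rewrite /c ge_max !le_max lexx/= le_min !ge_min zt lexx/= !orbT.
have clip z t : z <= t -> c t - c z <= t - z.
  move=> zt; rewrite /c; case: (leP z b) => zb; case: (leP t b) => tb;
    [case: (leP a z) => az; case: (leP a t) => at1| case: (leP a z) => az;
     case: (leP a b) => ab1| case: (leP a b) => ab1; case: (leP a t) => at1|
     case: (leP a b) => ab1]; lra.
under eq_bigr do rewrite (uc (y _)) (uc (x _)).
apply: (H n (c \o x) (c \o y)) => [k|i j _ _ [z /=]|].
- split; [|exact: nd|]; first by rewrite /c le_max lexx.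
  by rewrite /c ge_max ab ge_min lexx orbT.
- rewrite !in_itv/= /c !gt_max !lt_max !gt_min !lt_min.
  move=> [/andP[/andP[az hx] hy] /andP[/andP[_ hx'] hy']].
  have za : z < a = false by apply/negbTE; rewrite -leNgt ltW.
  move: hy hy'; rewrite za/= => /andP[zy zb] /andP[zy' _].
  have bz : b < z = false by apply/negbTE; rewrite -leNgt ltW.
  move: hx hx'; rewrite bz !orbF => hx hx'.
  by apply: txy => //; exists z; rewrite /= !in_itv/= hx zy hx' zy'.
- by apply: le_lt_trans dl; apply: ler_sum => k _; exact: clip.
Qed.

(** Since [u a = 0], the variation of [u] from [a] to [b] bounds every value. *)
Lemma global_ac_bounded (a b : R) (u : R -> R) : a <= b -> global_ac u ->
  (forall x, x <= a -> u x = 0) -> (forall x, b <= x -> u x = 0) ->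
  exists2 M : R, 0 <= M & forall x, `|u x| <= M.
Proof.
move=> ab uac ua ub.
have uaa x : x <= a -> u x = u a by move=> xa; rewrite !ua.
have V0 : tv_fun a u a <= tv_fun a u b by exact: tv_fun_nd.
exists (tv_fun a u b - tv_fun a u a); first by rewrite subr_ge0.
move=> x; case: (leP x a) => [/ua ->|/ltW ax]; first by rewrite normr0 subr_ge0.
case: (leP x b) => [xb|/ltW/ub ->]; last by rewrite normr0 subr_ge0.
have := tv_funB_ge uac uaa ax; rewrite (ua a)// subr0 => /le_trans; apply.
by rewrite lerB// tv_fun_nd.
Qed.

Lemma is_derive_shift_powR (r eps t : R) : 0 < t + eps ->
  is_derive t 1 (fun t => (t + eps) `^ r) (r * (t + eps) `^ (r - 1)).
Proof.
move=> te; have d1 : is_derive t 1 (fun t => t + eps) 1.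
  by apply: is_derive_eq; rewrite addr0.
have := @is_derive1_comp R (@powR R ^~ r) (fun t => t + eps) _ _ _ (is_derive1_powR r te) d1.
by rewrite mulr1.
Qed.

(** * The weighted inequality on a line *)

Section Line.
Variables (p eps a b : R) (g u : R -> R).
Hypotheses (p1 : 1 < p) (eps0 : 0 < eps) (ab : a <= b).
Hypothesis g0 : forall x, 0 <= g x.
Hypothesis gu : forall x : R, is_derive x 1 g (u x).
Hypothesis uac : global_ac u.
Hypothesis ua : forall x, x <= a -> u x = 0.
Hypothesis ub : forall x, b <= x -> u x = 0.

Let w x := u x ^+ 2 / (g x + eps).
(** This is [u w^(p-1)], factored so that one factor is a function of [u] alone and the other of [g]
    alone. *)
Let phi x := odd_powR (p - 1) (u x) * (g x + eps) `^ (- (p - 1)).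

Let q0 : 0 < p - 1. Proof. by rewrite subr_gt0. Qed.
Let q21 : 0 <= 2 * (p - 1) + 1.
Proof. by rewrite addr_ge0// mulr_ge0// ltW. Qed.
Let ge x : 0 < g x + eps. Proof. by rewrite ltr_wpDl. Qed.

Lemma weight_continuous : continuous w.
Proof.
move=> x; apply: cvgM.
  apply: (@continuous_comp _ _ _ u (fun t => t ^+ 2)); first exact: global_ac_continuous.
  exact: exprn_continuous.
apply: cvgV; first by rewrite gt_eqF.
apply: cvgD; last exact: cvg_cst.
apply: differentiable_continuous; apply/derivable1_diffP.
by have [] := gu x.
Qed.

(** Both factors are bounded. The first is a Lipschitz function of [u] because [u] is bounded; the
    second is a Lipschitz function of [g] because [g + eps >= eps], and [g] is itself Lipschitz
    because [g' = u]. *)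
Let global_ac_phi : global_ac phi.
Proof.
have [M M0 uM] := global_ac_bounded ab uac ua ub.
(* On [t >= 0], [Te] bounds [(t + eps)^(-(p-1))] and [Td] its derivative; [K1] bounds the derivative
   of [odd_powR (p - 1)] on [[-M, M]]. *)
pose Te := eps `^ (- (p - 1)); pose Td := (p - 1) * eps `^ (- (p - 1) - 1).
pose K1 := (2 * (p - 1) + 1) * (M ^+ 2) `^ (p - 1).
have K10 : 0 <= K1 by apply: mulr_ge0; rewrite ?powR_ge0.
have Te0 : 0 <= Te by exact: powR_ge0.
have Td0 : 0 <= Td by rewrite mulr_ge0 ?powR_ge0// ltW.
have Sb0 : 0 <= M * (M ^+ 2) `^ (p - 1) by rewrite mulr_ge0 ?powR_ge0.
have negpow r t : 0 <= r -> eps <= t -> t `^ (- r) <= eps `^ (- r).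
  move=> r0 et; rewrite !powRN lef_pV2 ?posrE ?powR_gt0//; last exact: lt_le_trans et.
  by apply: ge0_ler_powR; rewrite ?nnegrE// ?(ltW eps0)// (le_trans (ltW eps0)).
have sqle s : `|s| <= M -> (s ^+ 2) `^ (p - 1) <= (M ^+ 2) `^ (p - 1).
  move=> sM; apply: ge0_ler_powR; rewrite ?nnegrE ?sqr_ge0 ?(ltW q0)//.
  by rewrite -real_normK ?num_real// lerXn2r ?nnegrE.
have Slip s t : `|s| <= M -> `|t| <= M ->
    `|odd_powR (p - 1) s - odd_powR (p - 1) t| <= K1 * `|s - t|.
  move=> sM tM.
  apply: (@lip_of_derive (odd_powR (p - 1))
    (fun s => (2 * (p - 1) + 1) * (s ^+ 2) `^ (p - 1)) _ (- M) M).
  - by move=> x _; exact: is_derive_odd_powR.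
  - move=> x; rewrite in_itv/= -ler_norml => xM.
    rewrite ger0_norm; last by apply: mulr_ge0; rewrite ?powR_ge0.
    by rewrite ler_wpM2l// sqle.
  - by rewrite in_itv/= -ler_norml.
  - by rewrite in_itv/= -ler_norml.
have Tlip s t : 0 <= s -> 0 <= t ->
    `|(s + eps) `^ (- (p - 1)) - (t + eps) `^ (- (p - 1))| <= Td * `|s - t|.
  move=> s0 t0.
  apply: (@lip_of_derive (fun t => (t + eps) `^ (- (p - 1)))
    (fun t => - (p - 1) * (t + eps) `^ (- (p - 1) - 1)) _ 0 (Num.max s t)).
  - move=> x; rewrite in_itv/= => /andP[x0 _].
    by apply: is_derive_shift_powR; rewrite ltr_wpDl.
  - move=> x; rewrite in_itv/= => /andP[x0 _].
    rewrite normrM normrN (ger0_norm (ltW q0)) ger0_norm ?powR_ge0//.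
    rewrite ler_wpM2l ?(ltW q0)// -opprD negpow ?lerDr// ltW// ltr_wpDr// ltW.
  - by rewrite in_itv/= s0 le_max lexx.
  - by rewrite in_itv/= t0 le_max lexx orbT.
have glip x y : `|g x - g y| <= M * `|x - y|.
  apply: (@lip_of_derive g u _ (Num.min x y) (Num.max x y)) => //.
  - by rewrite in_itv/= ge_min le_max lexx.
  - by rewrite in_itv/= ge_min le_max lexx !orbT.
apply: (@global_ac_of_bound u phi (K1 * Te) (M * (M ^+ 2) `^ (p - 1) * (Td * M)) uac).
- exact: mulr_ge0.
- by rewrite mulr_ge0// mulr_ge0.
move=> x y; rewrite /phi.
set S1 := odd_powR _ (u x); set S2 := odd_powR _ (u y).
set T1 := (g x + eps) `^ _; set T2 := (g y + eps) `^ _.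
have -> : S1 * T1 - S2 * T2 = (S1 - S2) * T1 + S2 * (T1 - T2) by ring.
rewrite (le_trans (ler_normD _ _))// !normrM; apply: lerD.
  rewrite mulrAC; apply: ler_pM => //; first exact: Slip.
  by rewrite ger0_norm ?powR_ge0// negpow ?(ltW q0)// lerDr.
rewrite -[leRHS]mulrA; apply: ler_pM => //.
  apply: ler_pM => //.
  by rewrite ger0_norm ?powR_ge0// sqle.
rewrite (le_trans (Tlip _ _ (g0 x) (g0 y)))//.
by rewrite -[leRHS]mulrA ler_wpM2l.
Qed.

(** The term in [w^p] comes from differentiating the second factor: [g' = u] contributes one more
    [u], and [u * u * (u^2)^(p-1) = (u^2)^p]. *)
Let phi_derive (x d : R) : is_derive x 1 u d ->
  is_derive x 1 phi ((2 * (p - 1) + 1) * (w x `^ (p - 1)) * d - (p - 1) * w x `^ p).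
Proof.
move=> ud.
have d1 := @is_derive1_comp R (odd_powR (p - 1)) u _ _ _ (is_derive_odd_powR (u x) q0) ud.
have d2 := @is_derive1_comp R (fun t => (t + eps) `^ (- (p - 1))) g _ _ _
  (is_derive_shift_powR (- (p - 1)) (ge x)) (gu x).
have d3 := is_deriveM d1 d2.
apply: is_derive_eq d3 _; rewrite /GRing.scale/=.
have u2 : 0 <= u x ^+ 2 by exact: sqr_ge0.
have gei : 0 <= (g x + eps)^-1 by rewrite invr_ge0 ltW.
have wE r : w x `^ r = (u x ^+ 2) `^ r * (g x + eps) `^ (- r).
  by rewrite /w powRM// -(powR_inv1 (ltW (ge x))) -powRrM mulN1r.
rewrite !wE.
rewrite /odd_powR.
have <- := mulr_powRB1 u2 (lt_trans ltr01 p1).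
have -> : - (p - 1) - 1 = - p by ring.
ring.
Qed.

Lemma line_inequality : measurable_fun setT ('D_1 u) ->
  ((p - 1)%:E * \int[mu]_x (w x `^ p)%:E <=
   (2 * (p - 1) + 1)%:E * \int[mu]_x (w x `^ (p - 1) * `|'D_1 u x|)%:E)%E.
Proof.
move=> mDu.
have mw : measurable_fun setT w by apply: continuous_measurable_fun; exact: weight_continuous.
have mwr r : measurable_fun setT (fun x => w x `^ r).
  exact: (measurableT_comp (measurable_powR r)).
have mD : measurable_fun setT (fun x => w x `^ (p - 1) * `|'D_1 u x|).
  by apply: measurable_funM => //; exact: measurableT_comp.
have [M M0 uM] := global_ac_bounded ab uac ua ub.
have uaa x : x <= a -> u x = u a by move=> xa; rewrite !ua.
have ubb x : b <= x -> u x = u b by move=> xa; rewrite !ub.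
have pha x : x <= a -> phi x = 0 by move=> /ua xa; rewrite /phi xa /odd_powR !mul0r.
have phb x : b <= x -> phi x = 0 by move=> /ub xa; rewrite /phi xa /odd_powR !mul0r.
have phaa x : x <= a -> phi x = phi a by move=> xa; rewrite !pha.
have phbb x : b <= x -> phi x = phi b by move=> xa; rewrite !phb.
(* [h] is the derivative of [phi] almost everywhere to the right of [a - 1]. As [phi] vanishes at
   [a - 1] and at [b], the integral of [h] between them is [0]. *)
have [h [ih hE hD]] := global_ac_ae_derivable (a - 1) global_ac_phi ab phaa phbb.
have [h1 [_ _ h1D]] := global_ac_ae_derivable (a - 1) uac ab uaa ubb.
pose D : set (measurableTypeR R) := `]a - 1, b]%classic.
have mDD : measurable D by exact: measurable_itv.
have a1b : a - 1 <= b by rewrite (le_trans _ ab)// lerBlDr lerDl.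
pose A x := (p - 1) * w x `^ p.
have w0 x : 0 <= w x by rewrite divr_ge0 ?sqr_ge0// ltW.
have A0 x : 0 <= A x by rewrite mulr_ge0 ?powR_ge0// ltW.
have mA : measurable_fun setT A by exact: measurable_funM.
have AD : (\int[mu]_x (A x)%:E = \int[mu]_(x in D) (A x)%:E)%E.
  rewrite [RHS]integral_mkcond; apply: eq_integral => x _.
  rewrite patchE; case: ifPn => // /negP xD; rewrite /A /w.
  rewrite (_ : u x = 0) ?expr0n/= ?mul0r ?powR0 ?mulr0// ?gt_eqF ?(lt_trans ltr01)//.
  have [xa|ax] := leP x a; first exact: ua.
  have [bx|xb] := leP b x; first exact: ub.
  exfalso; apply: xD; rewrite inE /D /= in_itv/= (ltW xb) andbT.
  by rewrite (lt_trans _ ax)// ltrBlDr ltrDl.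
(* On [D], which has finite length, [w <= M^2 / eps]. Integrability is what lets the integral of [h]
   be added below. *)
have iA : mu.-integrable D (EFin \o A).
  apply: measurable_bounded_integrable => //.
  - have := lebesgue_stieltjes_itvoc (idfun : cumulative R R) a1b.
    rewrite -[X in (X < _)%E]/(lebesgue_stieltjes_measure _ _) => ->.
    by rewrite ltry.
  - exact: measurable_funTS.
  exists ((p - 1) * (M ^+ 2 / eps) `^ p); split; first exact: num_real.
  move=> K MK x _ /=; apply: (le_trans _ (ltW MK)); rewrite ger0_norm//.
  rewrite ler_wpM2l ?(ltW q0)//; apply: ge0_ler_powR.
  - by rewrite (le_trans ler01)// ltW.
  - by rewrite nnegrE.
  - by rewrite nnegrE divr_ge0 ?sqr_ge0// ltW.
  rewrite /w ler_pM ?sqr_ge0 ?invr_ge0 ?(ltW (ge x))//.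
    by rewrite -(real_normK (num_real (u x))) lerXn2r ?nnegrE.
  by rewrite lef_pV2 ?posrE// lerDr.
have ihD : mu.-integrable D (EFin \o h) by exact: integrableS ih.
have AE : (\int[mu]_(x in D) (A x)%:E = \int[mu]_(x in D) ((A x)%:E + (h x)%:E))%E.
  rewrite integralD//= -[X in (_ = _ + X)%E](hE _ _ a1b).
  by rewrite phb// pha ?subr0 ?adde0// lerBlDr lerDl.
rewrite -ge0_integralZl//; last 3 first.
- by apply/measurable_EFinP; exact: mwr.
- by move=> x _; rewrite lee_fin powR_ge0.
- by rewrite lee_fin ltW.
under eq_integral do rewrite -EFinM -/(A _).
rewrite AD AE.
have mAh : measurable_fun D (fun x => (A x)%:E + (h x)%:E)%E.
  by apply: emeasurable_funD; [exact: measurable_int iA|exact: measurable_int ihD].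
have mR : measurable_fun D (fun x => (2 * (p - 1) + 1)%:E * (w x `^ (p - 1) * `|'D_1 u x|)%:E)%E.
  by apply: measurable_funTS; apply/measurable_EFinP; exact: measurable_funM.
rewrite (le_trans (lee_abs _))// (le_trans (le_abse_integral mu mDD mAh))//.
rewrite -[leRHS]ge0_integralZl//; last 2 first.
- by apply/measurable_EFinP; exact: mD.
- by move=> x _; rewrite lee_fin mulr_ge0 ?powR_ge0.
rewrite (@ge0_ae_eq_integral _ _ _ mu D _
  (fun x => (2 * (p - 1) + 1)%:E * (w x `^ (p - 1) * `|'D_1 u x|)%:E)%E)//.
- apply: ge0_subset_integral => //.
    by apply/measurable_EFinP; exact: measurable_funM.
  by move=> x _; rewrite -EFinM lee_fin mulr_ge0// mulr_ge0// powR_ge0.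
- exact: measurableT_comp.
- by move=> x _; rewrite -EFinM lee_fin mulr_ge0// mulr_ge0// powR_ge0.
(* Where [u] is derivable and [h = phi'], the sum [A + h] is [(2p-1) w^(p-1) u']: the terms in [w^p]
   cancel. *)
move: hD h1D; apply: filterS2; first exact: (ae_filter_ringOfSetsType mu).
move=> x /= H H1 Dx.
have ax : a - 1 < x by move: Dx; rewrite /D /= in_itv/= => /andP[].
have [du _] := H1 ax; have [_ <-] := H ax.
have [_ ->] := phi_derive (derivableP du).
rewrite -EFinM /=; congr EFin.
rewrite [X in `|X|]addrC subrK normrM normrM (ger0_norm q21) ger0_norm ?powR_ge0//.
by rewrite mulrA.
Qed.
End Line.

End OneDim.

(** * Integration and measurability on tuples *)

Section TupleIntegral.
Context {R : realType}.
Local Notation RT := (measurableTypeR R).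
Local Notation mu := (@lebesgue_measure R).

Lemma lebesgue_tupleS_integral n (A : n.+1.-tuple RT -> \bar R) :
  measurable_fun setT A -> (forall t, 0 <= A t)%E ->
  (\int[lebesgue_tuple n.+1]_t A t =
   \int[(mu \x lebesgue_tuple n)%E]_z A (cons_pair z))%E.
Proof.
move=> mA A0.
rewrite [LHS](_ : _ =
  \int[pushforward (mu \x lebesgue_tuple n)%E (@cons_pair R n)]_t A t)%E//.
rewrite ge0_integral_pushforward//.
exact: measurable_cons_pair.
Qed.

Definition tuple_update n (t : n.-tuple RT) (i : 'I_n) (s : RT) : n.-tuple RT :=
  [tuple if j == i then s else tnth t j | j < n].

(** Tonelli, by induction on [n]. If [i] is the head coordinate, it is integrated innermost;
    otherwise the head is integrated outermost and the induction hypothesis compares the inner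
    integrals. *)
Lemma le_integral_tuple n (i : 'I_n) (A B : n.-tuple RT -> \bar R) :
  measurable_fun setT A -> measurable_fun setT B ->
  (forall t, 0 <= A t)%E -> (forall t, 0 <= B t)%E ->
  (forall t, \int[mu]_s A (tuple_update t i s) <= \int[mu]_s B (tuple_update t i s))%E ->
  (\int[lebesgue_tuple n]_t A t <= \int[lebesgue_tuple n]_t B t)%E.
Proof.
elim: n i A B => [[]//|n ih] i A B mA mB A0 B0 AB.
rewrite !lebesgue_tupleS_integral//.
have mAc : measurable_fun setT (A \o @cons_pair R n).
  by apply: measurableT_comp => //; exact: measurable_cons_pair.
have mBc : measurable_fun setT (B \o @cons_pair R n).
  by apply: measurableT_comp => //; exact: measurable_cons_pair.
case: (unliftP ord0 i) AB => [j ->|->] AB.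
- rewrite !fubini_tonelli1//; apply: ge0_le_integral => //.
  + by move=> x _; apply: integral_ge0 => t _; exact: A0.
  + exact: measurable_fun_fubini_tonelli_F.
  + exact: measurable_fun_fubini_tonelli_F.
  move=> x _; apply: (ih j).
  + exact: (measurableT_comp mAc (measurable_pair1 x)).
  + exact: (measurableT_comp mBc (measurable_pair1 x)).
  + by move=> t; exact: A0.
  + by move=> t; exact: B0.
  move=> t; have := AB (cons_pair (x, t)).
  suff E s : tuple_update (cons_pair (x, t)) (lift ord0 j) s = cons_pair (x, tuple_update t j s).
    by under eq_integral do rewrite E; under [X in (_ <= X)%E]eq_integral do rewrite E.
  apply: eq_from_tnth => k; rewrite tnth_mktuple.
  by case: (unliftP ord0 k) => [l ->|->]; rewrite /cons_pair ?tnthS ?tnth_mktuple//.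
- rewrite !fubini_tonelli2//; apply: ge0_le_integral => //.
  + by move=> x _; apply: integral_ge0 => t _; exact: A0.
  + exact: measurable_fun_fubini_tonelli_G.
  + exact: measurable_fun_fubini_tonelli_G.
  (* The head [0] is a placeholder that the update overwrites. *)
  move=> t _; have := AB (cons_pair (0, t)).
  suff E s : tuple_update (cons_pair (0, t)) ord0 s = cons_pair (s, t).
    by under eq_integral do rewrite E; under [X in (_ <= X)%E]eq_integral do rewrite E.
  apply: eq_from_tnth => k; rewrite tnth_mktuple.
  by case: (unliftP ord0 k) => [l ->|->]; rewrite /cons_pair ?tnthS.
Qed.

End TupleIntegral.

(** * Borel measurability on row vectors, including that of directional derivatives *)

Section RowMeasurable.
Context {R : realType} {d : nat}.
Local Notation RT := (measurableTypeR R).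
Local Notation rot := (@row_of_tuple R d).

Lemma rat_approx (x r : R) : 0 < r -> exists q : rat, `|x - ratr q| < r.
Proof.
move=> r0; have : x - r < x + r by lra.
move=> /rat_in_itvoo[q]; rewrite in_itv/= => /andP[h1 h2].
by exists q; rewrite ltr_norml; apply/andP; split; lra.
Qed.

(** An open set is a countable union of cubes with rational centres and radii [1/(k+1)], and the
    preimage of a cube is a finite intersection of coordinate conditions. *)
Lemma open_measurable_row (U : set 'rV[R]_d) : open U -> measurable (rot @^-1` U).
Proof.
move=> oU.
pose B (q : 'rV[rat]_d * nat) : set 'rV[R]_d :=
  [set y | forall i, ball (ratr (q.1 0 i) : R) (q.2.+1%:R^-1) (y 0 i)].
pose P q := B q `<=` U.
have -> : U = \bigcup_q (if pselect (P q) then B q else set0).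
  apply/seteqP; split => [x Ux|x [q _]]; last by case: pselect => // Pq; exact: Pq.
  have /nbhs_ballP[e /= e0 eU] : nbhs x U by exact: open_nbhs_nbhs.
  have e2 : 0 < e / 2 by rewrite divr_gt0.
  (* With radius below [e / 2], a cube that contains [x] stays within the ball of radius [e] about
     [x]. *)
  pose k := Num.bound (e / 2)^-1.
  have k0 : 0 < k.+1%:R^-1 :> R by rewrite invr_gt0.
  have ke : k.+1%:R^-1 < e / 2.
    rewrite invf_plt ?posrE//; apply: lt_le_trans (archi_boundP _) _.
      by rewrite invr_ge0 ltW.
    by rewrite ler_nat.
  have ex i := rat_approx (x 0 i) k0.
  pose q := \row_i sval (cid (ex i)).
  have qx i : `|x 0 i - ratr (q 0 i)| < k.+1%:R^-1 by rewrite mxE; case: cid.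
  exists (q, k) => //; case: pselect => [_ i|]; first by rewrite /ball/= distrC.
  move=> nP; exfalso; apply: nP => y By; apply: eU; split => // a i; rewrite ord1 /ball/=.
  have := By i; rewrite /ball/= => h1; have h2 := qx i.
  rewrite -(subrK (ratr (q 0 i)) (x 0 i)) -addrA.
  by rewrite (le_lt_trans (ler_normD _ _))// (splitr e) ltrD// (lt_trans _ ke).
rewrite preimage_bigcup; apply: countable_bigcupT_measurable => // q.
case: pselect => Pq; last by rewrite preimage_set0.
rewrite (_ : _ @^-1` _ = \bigcap_(i in [set: 'I_d])
   ((@tnth d RT)^~ i @^-1` (ball (ratr (q.1 0 i) : R) (q.2.+1%:R^-1)))).
  apply: fin_bigcap_measurable => // i _.
  by rewrite -[X in measurable X]setTI; apply: measurable_tnth => //; exact: measurable_ball.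
apply/seteqP; split => t /= H i.
- by move=> _; have := H i; rewrite mxE.
- by rewrite mxE; exact: H.
Qed.

Lemma closed_measurable_row (U : set 'rV[R]_d) : closed U -> measurable (rot @^-1` U).
Proof.
move=> cU; rewrite -[X in measurable X]setCK; apply: measurableC.
rewrite (_ : ~` (rot @^-1` U) = rot @^-1` (~` U))//.
by apply: open_measurable_row; exact: closed_openC.
Qed.

Lemma continuous_measurable_row (F : 'rV[R]_d -> R) : continuous F ->
  measurable_fun setT (F \o rot).
Proof.
move=> cF; apply: (measurability _ (RGenOpens.measurableE R)).
move=> _ [_ [a [b ->] <-]]; rewrite setTI comp_preimage.
apply: open_measurable_row; apply: open_comp; last exact: interval_open.
by move=> x _; exact: cF.
Qed.

Section deriv.
Variables (F : 'rV[R]_d -> R) (v : 'rV[R]_d).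
Hypothesis cF : continuous F.

Let Q (k : R) x := k^-1 *: (F (k *: v + x) - F x).

Let cQ k : continuous (Q k).
Proof.
move=> x; apply: (@cvgZ _ R^o _ (nbhs x) _ (cst k^-1) (fun x => F (k *: v + x) - F x) k^-1).
  exact: cvg_cst.
apply: cvgB; last exact: cF.
apply: (@continuous_comp _ _ _ (fun x => k *: v + x) F); last exact: cF.
by apply: (@cvgD _ _ _ (nbhs x) _ (cst (k *: v)) id); [exact: cvg_cst|exact: cvg_id].
Qed.

(** The Cauchy condition for the difference quotients at precision [1/(n+1)], for steps below
    [1/(m+1)]. *)
Let C (n m : nat) := [set x | forall k l : R, k != 0 -> l != 0 ->
  `|k| < m.+1%:R^-1 -> `|l| < m.+1%:R^-1 -> `|Q k x - Q l x| <= n.+1%:R^-1].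

(** For fixed steps the condition is closed because the quotients are continuous; an arbitrary
    intersection of closed sets is closed, so the steps may range over all reals. *)
Let closedC n m : closed (C n m).
Proof.
rewrite (_ : C n m = \bigcap_(z in [set z : R * R | [/\ z.1 != 0, z.2 != 0,
   `|z.1| < m.+1%:R^-1 & `|z.2| < m.+1%:R^-1]]) [set x | `|Q z.1 x - Q z.2 x| <= n.+1%:R^-1]).
  apply: closed_bigI => -[k l] _ /=.
  apply: (@closed_comp _ _ (fun x => `|Q k x - Q l x|) [set y | y <= n.+1%:R^-1]).
    move=> x _; apply: (@continuous_comp _ _ _ (fun x => Q k x - Q l x) (fun y : R => `|y|)).
      by apply: (@continuousB _ R^o); exact: cQ.
    exact: norm_continuous.
  exact: closed_le.
apply/seteqP; split => x H; first by move=> [k l] [/= *]; exact: H.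
by move=> k l *; exact: (H (k, l)).
Qed.

(** The Cauchy criterion in the complete space [R]; precisions and step bounds of the form [1/(n+1)]
    suffice, which makes the operations countable. *)
Let derivableE : [set x | derivable F x v] = \bigcap_n \bigcup_m C n m.
Proof.
apply/seteqP; split => [x /= /cvg_ex[l Fl] n _|x H].
- have n0 : 0 < n.+1%:R^-1 / 2 :> R by rewrite divr_gt0.
  move/cvgrPdist_lt : Fl => /(_ _ n0)[/= e /= e0 He].
  exists (Num.bound e^-1) => // k h k0 h0 ke he.
  have be : (Num.bound e^-1).+1%:R^-1 < e.
    rewrite invf_plt ?posrE//; apply: lt_le_trans (archi_boundP _) _.
      by rewrite invr_ge0 ltW.
    by rewrite ler_nat.
  have h1 : `|l - Q k x| < n.+1%:R^-1 / 2.
    by apply: He => //=; rewrite sub0r normrN (lt_trans ke).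
  have h2 : `|l - Q h x| < n.+1%:R^-1 / 2.
    by apply: He => //=; rewrite sub0r normrN (lt_trans he).
  have -> : Q k x - Q h x = (l - Q h x) - (l - Q k x) by ring.
  by rewrite (le_trans (ler_normB _ _))// (splitr n.+1%:R^-1) lerD// ltW.
- apply: cauchy_cvg; apply/cauchyP => /= e e0.
  have e2 : 0 < e / 2 by rewrite divr_gt0.
  have ke : (Num.bound (e / 2)^-1).+1%:R^-1 < e / 2.
    rewrite invf_plt ?posrE//; apply: lt_le_trans (archi_boundP _) _.
      by rewrite invr_ge0 ltW.
    by rewrite ler_nat.
  have [m _ Hm] := H (Num.bound (e / 2)^-1) Logic.I.
  have m0 : 0 < m.+1%:R^-1 / 2 :> R by rewrite divr_gt0.
  (* Any quotient with an admissible step may serve as centre; half the step bound is admissible. *)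
  exists (Q (m.+1%:R^-1 / 2) x).
  exists m.+1%:R^-1 => //= k; rewrite /= sub0r normrN => km k0.
  rewrite /ball/=; apply: le_lt_trans (lt_trans ke _).
    by apply: Hm => //; rewrite gtr0_norm// ltr_pdivrMr// ltr_pMr// ltr1n.
  by rewrite ltr_pdivrMr// ltr_pMr// ltr1n.
Qed.

(** On the measurable set of derivability the derivative is the limit of the quotients with steps
    [1/(n+1)]; elsewhere it is [point], the default value of a limit. *)
Lemma measurable_derive_row : measurable_fun setT ('D_v F \o rot).
Proof.
pose D := [set x | derivable F x v].
have mD : measurable (rot @^-1` D).
  rewrite /D derivableE preimage_bigcap; apply: bigcapT_measurable => n.
  rewrite preimage_bigcup; apply: bigcupT_measurable => m.
  exact: closed_measurable_row.
pose h n t := if pselect (D (rot t)) then Q n.+1%:R^-1 (rot t) else point.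
apply: (@measurable_fun_cvg _ _ _ _ h).
- move=> n; rewrite (_ : h n = fun t => if t \in rot @^-1` D then Q n.+1%:R^-1 (rot t) else point).
    apply: measurable_fun_ifT => //.
      apply: (@measurable_fun_bool _ _ _ _ true); rewrite setTI.
      rewrite (_ : _ @^-1` _ = rot @^-1` D)//.
      by apply/seteqP; split => t /=; [move/set_mem|move/mem_set].
    exact: continuous_measurable_row.
  by apply/funext => t; rewrite /h; case: pselect => H; [rewrite mem_set|rewrite memNset].
- move=> t _; rewrite /h /=; case: pselect => H; last first.
    rewrite /derive dvgP//; exact: cvg_cst.
  have := H => /cvg_ex[l Fl]; rewrite /derive (cvg_lim _ Fl)//.
  apply/cvgrPdist_lt => e e0; move/cvgrPdist_lt : Fl => /(_ _ e0)[/= r /= r0 Hr].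
  exists (Num.bound r^-1) => // n /= rn; apply: Hr => //=.
  rewrite sub0r normrN gtr0_norm ?invr_gt0// invf_plt ?posrE//.
  apply: lt_le_trans (archi_boundP _) _; first by rewrite invr_ge0 ltW.
  by rewrite ler_nat (leq_trans rn).
Qed.

End deriv.
End RowMeasurable.

(** * The estimate for one coordinate *)

Section Lines.
Context {R : realType} {V : normedModType R}.
Variables (F : V -> R) (x v : V).

Let line_quotient (s : R) :
  (fun h : R => h^-1 *: (F (x + (h *: (1 : R) + s) *: v) - F (x + s *: v))) =
  (fun h : R => h^-1 *: (F (h *: v + (x + s *: v)) - F (x + s *: v))).
Proof.
apply/funext => h; congr (_ *: (F _ - _)).
by rewrite [h *: (1 : R)]mulr1 scalerDl addrCA.
Qed.

Lemma derive_line (s : R) : 'D_1 (fun s : R => F (x + s *: v)) s = 'D_v F (x + s *: v).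
Proof. by rewrite /derive /= line_quotient. Qed.

Lemma derivable_line (s : R) : derivable F (x + s *: v) v ->
  derivable (fun s : R => F (x + s *: v)) s 1.
Proof. by rewrite /derivable /= line_quotient. Qed.

End Lines.

(** * From lines to one coordinate direction of the cube *)

Section Coordinate.
Context {R : realType} {d : nat}.
Local Notation RT := (measurableTypeR R).
Local Notation rot := (@row_of_tuple R d).
Local Notation mu := (lebesgue_tuple (R := R) d).

(* Such points are minima of [f] along every line. *)
Lemma partial_eq0 (f : 'rV[R]_d -> R) (i : 'I_d) x :
  (forall x, differentiable f x) -> (forall x, 0 <= f x) -> f x = 0 ->
  partial i f x = 0.
Proof.
move=> df f0 fx; have := @derive1_at_min R (fun s : R => f (x + s *: basis_vec i)) (-1) 1 0.
case.
- by rewrite (@le_trans _ _ 0).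
- by move=> s _; apply: derivable_line; exact: diff_derivable.
- by rewrite in_itv/= ltrN10 ltr01.
- by move=> s _; rewrite scale0r addr0 fx.
by move=> _; rewrite derive_line scale0r addr0.
Qed.

Lemma row_tuple_update (t : d.-tuple RT) (i : 'I_d) (s : R) :
  rot (tuple_update t i s) = rot (tuple_update t i 0) + s *: basis_vec i.
Proof.
apply/rowP => j; rewrite !mxE !tnth_mktuple eqxx /= eq_sym; case: eqP => _.
  by rewrite mulr1 add0r.
by rewrite mulr0 addr0.
Qed.

Lemma measurable_tuple_update (t : d.-tuple RT) (i : 'I_d) : measurable_fun setT (tuple_update t i).
Proof.
apply/measurable_fun_tnthP => j; rewrite (_ : _ \o _ = fun s => if j == i then s else tnth t j).
  by case: eqP => _; [exact: measurable_id|exact: measurable_cst].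
by apply/funext => s /=; rewrite tnth_mktuple.
Qed.

Definition unit_cube : set (d.-tuple RT) := [set t | forall i, `[0, 1]%classic (tnth t i)].

Lemma cube_measure : mu unit_cube = 1%E.
Proof.
rewrite (lebesgue_tuple_box (A := fun=> `[0, 1]%classic))//.
rewrite big1// => i _.
have := @lebesgue_measure_itv R `[0, 1]; rewrite /= lte_fin ltr01 => ->.
by rewrite oppr0 adde0.
Qed.

Lemma measurable_cube : measurable unit_cube.
Proof.
rewrite (_ : unit_cube = \bigcap_(i in [set: 'I_d]) ((@tnth d RT)^~ i @^-1` `[0, 1]%classic)).
  apply: fin_bigcap_measurable => // i _.
  by rewrite -[X in measurable X]setTI; apply: measurable_tnth.
by apply/seteqP; split => t /= H i; [move=> _|]; exact: H.
Qed.

Lemma continuous_bounded_cube (W : 'rV[R]_d -> R) : continuous W ->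
  exists K : R, 0 <= K /\ forall t, unit_cube t -> `|W (rot t)| <= K.
Proof.
move=> cW.
have /continuous_compact : {within
    [set v : 'rV[R]_d | forall i, `[0, 1]%classic (v ord0 i)], continuous W}.
  exact: continuous_subspaceT.
have cc := @rV_compact R d (fun=> `[0, 1]%classic) (fun=> @segment_compact R 0 1).
move=> /(_ cc)/(@compact_bounded R R^o)[M [_ HM]].
exists (`|M| + 1); split; first by rewrite addr_ge0.
move=> t ct; apply: (HM (`|M| + 1)); first by rewrite ltr_pwDr// ler_norm.
by exists (rot t) => //= i; rewrite mxE; exact: ct.
Qed.

Variables (p : R) (f : 'rV[R]_d -> R) (i : 'I_d).
Hypotheses (p1 : 1 < p) (fC1 : C1 f) (f0 : forall x, 0 <= f x)
  (fsupp : supported_on_unit_cube f) (fac : abs_continuous_grad f).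

Let q0 : 0 < p - 1. Proof. by rewrite subr_gt0. Qed.
Let p0 : 0 < p. Proof. exact: lt_trans p1. Qed.

Let cf : continuous f.
Proof. by move=> x; apply: differentiable_continuous; exact: fC1.1. Qed.
Let cu : continuous (partial i f). Proof. exact: fC1.2. Qed.

Let off_cube t : ~ unit_cube t -> f (rot t) = 0.
Proof.
move=> nt; apply/eqP; apply: contra_notT nt => /fsupp ft j.
by have := ft j; rewrite mxE /= in_itv.
Qed.

Let w (e : R) x := partial i f x ^+ 2 / (f x + e).
Let P2 t := partial2 i f (rot t).
Let N := Lp_norm p (partial2 i f).
Let K := (2 * (p - 1) + 1) / (p - 1).

Let fe e x : 0 < e -> 0 < f x + e. Proof. by move=> e0; rewrite ltr_wpDl. Qed.
Let w_ge0 e x : 0 < e -> 0 <= w e x.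
Proof. by move=> e0; rewrite divr_ge0 ?sqr_ge0// ltW// fe. Qed.

Let w_continuous e : 0 < e -> continuous (w e).
Proof.
move=> e0 x; apply: (@continuousM R _ (fun x => partial i f x ^+ 2)).
  apply: (@continuous_comp _ _ _ (partial i f) (fun t => t ^+ 2)); first exact: cu.
  exact: exprn_continuous.
apply: continuousV; first by rewrite gt_eqF// fe.
by apply: (@continuousD _ R^o _ f (cst e)); [exact: cf|exact: cst_continuous].
Qed.

Let mw e : 0 < e -> measurable_fun setT (w e \o rot).
Proof. by move=> e0; apply: continuous_measurable_row; exact: w_continuous. Qed.

Let mP2 : measurable_fun setT P2.
Proof. exact: measurable_derive_row. Qed.

Let mwr e r : 0 < e -> measurable_fun setT (fun t => w e (rot t) `^ r).
Proof. by move=> e0; exact: (measurableT_comp (measurable_powR r) (mw e0)). Qed.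

Let w_off e t : 0 < e -> ~ unit_cube t -> w e (rot t) = 0.
Proof.
move=> e0 /off_cube ft; rewrite /w (partial_eq0 i _ _ ft) ?expr0n/= ?mul0r//.
exact: fC1.1.
Qed.

(** [line_inequality] holds on every line parallel to the [i]-th axis, and [le_integral_tuple]
    integrates it over these lines. *)
Lemma coordinate_tonelli e : 0 < e ->
  ((p - 1)%:E * \int[mu]_t (w e (rot t) `^ p)%:E <=
   (2 * (p - 1) + 1)%:E * \int[mu]_t (w e (rot t) `^ (p - 1) * `|P2 t|)%:E)%E.
Proof.
move=> e0; have k0 : 0 <= 2 * (p - 1) + 1 by rewrite addr_ge0// mulr_ge0// ltW.
have mR : measurable_fun setT (fun t => w e (rot t) `^ (p - 1) * `|P2 t|).
  by apply: measurable_funM; [exact: mwr|exact: measurableT_comp].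
have R0 t : 0 <= w e (rot t) `^ (p - 1) * `|P2 t| by rewrite mulr_ge0 ?powR_ge0.
rewrite -!ge0_integralZl//; try (by rewrite lee_fin// ltW);
  try (by move=> t _; rewrite lee_fin ?powR_ge0);
  try (by apply/measurable_EFinP => //; exact: mwr).
apply: (@le_integral_tuple R d i (fun t => (p - 1)%:E * (w e (rot t) `^ p)%:E)%E
  (fun t => (2 * (p - 1) + 1)%:E * (w e (rot t) `^ (p - 1) * `|P2 t|)%:E)%E).
- by apply/measurable_EFinP; apply: measurable_funM => //; exact: mwr.
- by apply/measurable_EFinP; exact: measurable_funM.
- by move=> t; rewrite -EFinM lee_fin mulr_ge0 ?powR_ge0// ltW.
- by move=> t; rewrite -EFinM lee_fin mulr_ge0.
move=> t; pose x := rot (tuple_update t i 0); pose v := basis_vec i : 'rV[R]_d.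
pose g s := f (x + s *: v); pose u s := partial i f (x + s *: v).
have du s : 'D_1 u s = P2 (tuple_update t i s).
  by rewrite derive_line /P2 row_tuple_update.
have gu (s : R) : is_derive s 1 g (u s).
  apply: DeriveDef; last exact: derive_line.
  by apply: derivable_line; apply: diff_derivable; exact: fC1.1.
(* Hence the parameter [s] is the [i]-th coordinate, and the line is outside the cube unless
   [0 <= s <= 1]. *)
have x0 : x 0 i = 0 by rewrite mxE tnth_mktuple eqxx.
have u_eq0 s : ~~ (0 <= s <= 1) -> u s = 0.
  move=> s01; apply: partial_eq0 => //; first exact: fC1.1.
  apply/eqP; apply: contraNT s01 => /fsupp/(_ i).
  have -> : (x + s *: v) 0 i = x 0 i + s * v 0 i by rewrite !mxE.
  by rewrite x0 mxE !eqxx mulr1 add0r.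
(* [-1, 2] rather than [0, 1], so that no continuity argument is needed to see
   that [u] vanishes at the endpoints. *)
have ua s : s <= -1 -> u s = 0 by move=> s1; apply: u_eq0; apply/negP => /andP[]; lra.
have ub s : 2 <= s -> u s = 0 by move=> s1; apply: u_eq0; apply/negP => /andP[]; lra.
have ab : -1 <= 2 :> R by lra.
have uac : global_ac u.
  apply: (global_ac_of_abs_continuous_on ab); first exact: fac.
    by move=> s s1; rewrite !ua.
  by move=> s s1; rewrite !ub.
have mdu : measurable_fun setT ('D_1 u).
  rewrite (_ : 'D_1 u = P2 \o tuple_update t i); last exact/funext.
  by apply: measurableT_comp => //; exact: measurable_tuple_update.
have := line_inequality p1 e0 ab (fun s => f0 _) gu uac ua ub mdu.
have E s : u s ^+ 2 / (g s + e) = w e (rot (tuple_update t i s)) by rewrite row_tuple_update.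
under eq_integral do rewrite E.
under [X in (_ <= _ * X)%E -> _]eq_integral do rewrite E du.
have mwt r : measurable_fun setT (fun s => w e (rot (tuple_update t i s)) `^ r).
  by apply: (measurableT_comp (mwr r e0)); exact: measurable_tuple_update.
rewrite -!ge0_integralZl//; try (by rewrite lee_fin// ltW);
  try (by move=> s _; rewrite lee_fin ?powR_ge0).
- by apply/measurable_EFinP; apply: (measurableT_comp mR); exact: measurable_tuple_update.
- by apply/measurable_EFinP; exact: mwt.
Qed.


(** [w e] is continuous, hence bounded on the cube, and vanishes off it. Finiteness allows the
    division in the next proof. *)
Lemma coordinate_finite e : 0 < e -> (\int[mu]_t (w e (rot t) `^ p)%:E < +oo)%E.
Proof.
move=> e0; have [M [M0 wM]] := continuous_bounded_cube (w_continuous e0).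
have -> : (\int[mu]_t (w e (rot t) `^ p)%:E = \int[mu]_(t in unit_cube) (w e (rot t) `^ p)%:E)%E.
  rewrite [RHS]integral_mkcond; apply: eq_integral => t _.
  rewrite patchE; case: ifPn => // /negP tc.
  by rewrite w_off ?powR0 ?gt_eqF// => ct; apply: tc; rewrite inE.
apply: (@le_lt_trans _ _ (\int[mu]_(t in unit_cube) (cst (M `^ p)%:E) t)%E); last first.
  rewrite (integral_cst mu measurable_cube) [X in (_ * X < _)%E](_ : _ = 1%E) ?mule1 ?ltry//.
  exact: cube_measure.
apply: ge0_le_integral => //.
- exact: measurable_cube.
- by move=> t _; rewrite lee_fin powR_ge0.
- by apply/measurable_EFinP; apply: measurable_funTS; exact: mwr.
- move=> t ct; rewrite lee_fin; apply: ge0_ler_powR; rewrite ?nnegrE ?w_ge0 ?(ltW p0)//.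
  by rewrite (le_trans _ (wM t ct))// ler_norm.
Qed.

(** Write [I] for the integral of [w^p]. Hoelder with exponents [q = p/(p-1)] and [p] bounds the
    right side of [coordinate_tonelli] by a multiple of [I^(1/q) N], and dividing by [I^(1/q)]
    leaves [I^(1/p)]. *)
Lemma coordinate_hoelder e : 0 < e ->
  ((\int[mu]_t (w e (rot t) `^ p)%:E) `^ p^-1 <= K%:E * N)%E.
Proof.
move=> e0; have fin := coordinate_finite e0.
have I0 : (0 <= \int[mu]_t (w e (rot t) `^ p)%:E)%E.
  by apply: integral_ge0 => t _; rewrite lee_fin powR_ge0.
have N0 : (0 <= N)%E by exact: Lnorm_ge0.
have k0 : 0 < 2 * (p - 1) + 1 by rewrite ltr_wpDl// mulr_ge0// ltW.
have K0 : 0 < K by rewrite divr_gt0.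
pose q := p / (p - 1).
have q0' : 0 < q by exact: divr_gt0.
have pq : q^-1 + p^-1 = 1.
  by rewrite /q invf_div mulrBl mul1r mulfV ?gt_eqF// subrK.
have mf : measurable_fun setT (fun t => w e (rot t) `^ (p - 1)) by exact: mwr.
have := hoelder mu mf mP2 q0' p0 pq.
rewrite Lnorm1.
have -> : (\int[mu]_t `|(((fun t => w e (rot t) `^ (p - 1)) \* P2) t)%:E| =
    \int[mu]_t (w e (rot t) `^ (p - 1) * `|P2 t|)%:E)%E.
  by apply: eq_integral => t _; rewrite /= normrM ger0_norm// powR_ge0.
(* The choice of [q] gives [(w^(p-1))^q = w^p]. *)
have -> : (Lnorm mu q%:E (EFin \o (fun t => (w e (rot t) `^ (p - 1))%R)) =
    (\int[mu]_t (w e (rot t) `^ p)%:E) `^ q^-1)%E.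
  rewrite unlock; congr (_ `^ _)%E; apply: eq_integral => t _ /=.
  rewrite ger0_norm ?powR_ge0// -powRrM; congr (_ `^ _)%:E.
  by rewrite /q mulrC divfK// gt_eqF.
rewrite [X in (_ <= _ * X)%E](_ : _ = N)// => H1; have := coordinate_tonelli e0.
move/le_trans => /(_ _ (lee_wpmul2l _ H1)); rewrite lee_fin => /(_ (ltW k0)).
move: fin I0; case: (\int[mu]_t _)%E => [r|//|//] _; rewrite lee_fin => r0.
(* If [N] is infinite, so is the right side, as [K > 0]. *)
rewrite !poweR_EFin; move: N0; case: (N) => [n|_ _|//]; last first.
  by rewrite gt0_muley ?lte_fin// leey.
rewrite lee_fin => n0; rewrite -!EFinM !lee_fin => H.
have [->|rn0] := eqVneq r 0; first by rewrite powR0 ?invr_eq0 ?gt_eqF// mulr_ge0// ltW.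
have rp : 0 < r by rewrite lt_neqAle eq_sym rn0.
have rq : 0 < r `^ q^-1 by exact: powR_gt0.
rewrite /K mulrAC ler_pdivlMr// -(ler_pM2r rq) -mulrA (mulrC (p - 1)) mulrA.
rewrite -powRD; last by rewrite rn0 implybT.
rewrite (addrC p^-1) pq powRr1// [r * _]mulrC -mulrA (mulrC n).
exact: H.
Qed.

(** Hoelder against the indicator of the cube, whose [L_q] norm is [1]; multiplying [w] by it
    changes nothing, since [w] vanishes off the cube. *)
Lemma coordinate_eps e : 0 < e -> (\int[mu]_t (w e (rot t))%:E <= K%:E * N)%E.
Proof.
move=> e0; apply: le_trans (coordinate_hoelder e0).
pose q := p / (p - 1).
have q0' : 0 < q by exact: divr_gt0.
have pq : p^-1 + q^-1 = 1.
  by rewrite /q invf_div mulrBl mul1r mulfV ?gt_eqF// addrC subrK.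
have m1 : measurable_fun setT (\1_unit_cube : _ -> R) by apply: measurable_indic; exact: measurable_cube.
have := hoelder mu (mw e0) m1 p0 q0' pq.
rewrite Lnorm1.
have -> : (\int[mu]_t `|(((w e \o rot) \* \1_unit_cube) t)%:E| = \int[mu]_t (w e (rot t))%:E)%E.
  apply: eq_integral => t _; congr EFin; rewrite /= indicE.
  case: (boolP (t \in unit_cube)) => tc; first by rewrite mulr1 ger0_norm// w_ge0.
  by rewrite mulr0 normr0 w_off// => ct; move/negP: tc; apply; rewrite inE.
have -> : Lnorm mu q%:E (EFin \o (\1_unit_cube : _ -> R)) = 1%E.
  rewrite unlock (_ : (\int[mu]_t _)%E = 1%E) ?poweR1r//.
  rewrite -cube_measure -[in RHS](setIT unit_cube) -integral_indic//; last exact: measurable_cube.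
  apply: eq_integral => t _ /=; rewrite indicE ger0_norm//.
  by case: (_ \in _) => /=; rewrite ?powR1// powR0// gt_eqF.
rewrite mule1 => /le_trans; apply.
rewrite unlock; under eq_integral do rewrite /= ger0_norm ?w_ge0//.
exact: lexx.
Qed.

Let cvg_w t : w n.+1%:R^-1 (rot t) @[n --> \oo] --> partial i f (rot t) ^+ 2 / f (rot t).
Proof.
(* Where [f] vanishes so does its partial derivative, so every [w] is [0] there, in agreement with
   the convention for division by [0]. *)
have [fx|fx] := eqVneq (f (rot t)) 0.
  have ux : partial i f (rot t) = 0 by apply: partial_eq0 => //; exact: fC1.1.
  under eq_fun do rewrite /w ux expr0n/= mul0r.
  by rewrite ux expr0n/= mul0r; exact: cvg_cst.
apply: cvgM; first exact: cvg_cst.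
apply: cvgV => //; rewrite -[X in _ --> X]addr0.
by apply: cvgD; [exact: cvg_cst|exact: cvg_harmonic].
Qed.

Lemma coordinate_measurable :
  measurable_fun setT (fun t => partial i f (rot t) ^+ 2 / f (rot t)).
Proof.
apply: (@measurable_fun_cvg _ _ _ _ (fun n t => w n.+1%:R^-1 (rot t))) => //.
by move=> n; apply: mw; rewrite invr_gt0.
Qed.

Lemma coordinate_bound :
  (\int[mu]_t (partial i f (rot t) ^+ 2 / f (rot t))%:E <= K%:E * N)%E.
Proof.
pose e n : R := n.+1%:R^-1.
have e0 n : 0 < e n by rewrite invr_gt0.
pose h n t := (w (e n) (rot t))%:E.
have cvh t : h n t @[n --> \oo] --> (partial i f (rot t) ^+ 2 / f (rot t))%:E.
  by apply: cvg_EFin; [exact: nearW|exact: cvg_w].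
have mh n : measurable_fun setT (h n) by apply/measurable_EFinP; exact: mw.
have h0 n t : setT t -> (0 <= h n t)%E by move=> _; rewrite lee_fin w_ge0.
have ndh t : setT t -> nondecreasing_seq (h ^~ t).
  (* The denominators [f + e n] decrease with [n], so the quotients increase. *)
  move=> _ m n mn; rewrite lee_fin ler_wpM2l ?sqr_ge0// lef_pV2 ?posrE ?fe//.
  by rewrite lerD2l lef_pV2 ?posrE// ler_nat.
have := @cvg_monotone_convergence _ _ _ mu _ measurableT h mh h0 ndh.
under [X in _ --> X -> _]eq_integral => t _ do rewrite (cvg_lim _ (cvh t))//.
move=> cv; rewrite -(cvg_lim _ cv)//; apply: lime_le; first by apply/cvg_ex; eexists; exact: cv.
by apply: nearW => n; exact: coordinate_eps.
Qed.

End Coordinate.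

(** * Summation over the coordinates *)

Theorem theorem5 (R : realType) (p : R) (hp : 1 < p) :
  exists2 C : R, 0 < C &
    forall (d : nat) (f : 'rV[R]_d -> R),
      (0 < d)%N ->
      C1 f -> pdf f -> supported_on_unit_cube f -> abs_continuous_grad f ->
      (fisher_information f <= C%:E * \sum_(i < d) Lp_norm p (partial2 i f))%E.
Proof.
have q0 : 0 < p - 1 by rewrite subr_gt0.
(* This is [(2p-1)/(p-1)], the constant of [coordinate_bound], the same in every dimension and
   direction. *)
exists ((2 * (p - 1) + 1) / (p - 1)).
  by rewrite divr_gt0// ltr_wpDl// mulr_ge0// ltW.
move=> d f _ fC1 [f0 _] fsupp fac.
rewrite ge0_sume_distrr; last by move=> i _; exact: Lnorm_ge0.
rewrite /fisher_information.
have E t : ((enorm (grad f (row_of_tuple t)) ^+ 2 / f (row_of_tuple t))%:E =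
    \sum_(i < d) (partial i f (row_of_tuple t) ^+ 2 / f (row_of_tuple t))%:E)%E.
  rewrite sumEFin /enorm sqr_sqrtr; last by apply: sumr_ge0 => i _; exact: sqr_ge0.
  by rewrite mulr_suml; under eq_bigr do rewrite mxE.
under eq_integral do rewrite E.
rewrite ge0_integral_sum//.
- by apply: lee_sum => i _; exact: coordinate_bound.
- by move=> i; apply/measurable_EFinP; exact: coordinate_measurable.
- by move=> i t _; rewrite lee_fin divr_ge0// sqr_ge0.
Qed.
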